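(* Let $M$ be a simply laced spherical Coxeter diagram with Weyl group $W$, and let $\mathcal B$ be an admissible $W$-orbit of sets of mutually orthogonal positive roots. Then there exists a partial order $<$ on $\mathcal B$ with a unique maximal element $B_0$ for which the construction described in the context is well defined and for which the assignment $s_i\mapsto\tau_i$ ($i$ a node of $M$) extends to a homomorphism of monoids $A^+\to\operatorname{End}_Z(V)$. Here ''well defined'' means: for every $B\ne B_0$ there is a node $j$ with $B<r_jB$; for every $B\in\mathcal B$ and node $i$ with $\alpha_i\notin B\cup B^\perp$ the sets $B$ and $r_iB$ are distinct and comparable; and for every $B\in\mathcal B$ and node $i$ with $\alpha_i\in B^\perp$, all words $v\in V(B,i)$ give the same image of $v^{-1}s_iv$ in $H$, and this element $h_{B,i}$ lies in $Z$.
   Context: Let $M$ be a spherical simply laced Coxeter diagram (each connected component of type A, D or E) with nodes $1,\dots,n$; for distinct nodes write $i\sim j$ if they are joined by an edge and $i\not\sim j$ otherwise. Let $(W,R)$, $R=\{r_1,\dots,r_n\}$, be the Coxeter system of type $M$, with root system $\Phi$, positive roots $\Phi^+$, fundamental roots $\alpha_1,\dots,\alpha_n$, $r_i$ the reflection in $\alpha_i$, and invariant inner product with $(\alpha_i,\alpha_i)=2$, $(\alpha_i,\alpha_j)=-1$ if $i\sim j$ and $0$ otherwise. For a set $B$ of mutually orthogonal positive roots and $w\in W$ put $wB=\Phi^+\cap\{\pm w\beta:\beta\in B\}$ (so e.g. $r_i\{\alpha_i\}=\{\alpha_i\}$); $B^\perp$ is the set of roots orthogonal to every element of $B$. A $W$-orbit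 $\mathcal B$ of such sets is admissible if for every $B\in\mathcal B$, all nodes $i,j$ with $i\not\sim j$ and every root $\gamma$ with $\gamma,\gamma-\alpha_i+\alpha_j\in B$, we have $r_iB=r_jB$. The Artin group $A$ of type $M$ has generators $s_1,\dots,s_n$ and relations $s_is_js_i=s_js_is_j$ if $i\sim j$, $s_is_j=s_js_i$ if $i\not\sim j$; $A^+$ is the monoid with the same presentation. Let $m$ be an indeterminate and $H$ the Hecke algebra of type $M$ over $\mathbb Q(m)$, the quotient of the group algebra $\mathbb Q(m)[A]$ by the relations $s_i^2=1-ms_i$. Given a partial order $<$ on $\mathcal B$ with unique maximal element $B_0$: let $C$ be the set of nodes $i$ with $\alpha_i\in B_0^\perp$ and $Z$ the subalgebra of $H$ generated by the $s_i$, $i\in C$ (the Hecke algebra of type $C$). For $B\in\mathcal B$ and a node $i$ with $\alpha_i\in B^\perp$, let $V(B,i)\subseteq A$ be defined inductively (smallest family of sets satisfying): $1\in V(B_0,i)$; if $j$ is a node with $B<r_jB$ and $j\not\sim i$, then $s_jv\in V(B,i)$ for every $v\in V(r_jB,i)$; if $j$ is a node with $B<r_jB$ and $j\sim i$, then $s_js_iv\in V(B,i)$ for every $v\in V(r_ir_jB,j)$. Set $h_{B,i}$ = image of $v^{-1}s_iv$ in $H$ for $v\in V(B,i)$. Let $V$ be the free right $Z$-module with basis $\{x_B: B\in\mathcal B\}$, and define the right $Z$-linear map $\tau_i$ on $V$ by: $\tau_ix_B=0$ if $\alpha_i\in B$; $\tau_ix_B=x_Bh_{B,i}$ if $\alpha_i\in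 B^\perp$; $\tau_ix_B=x_{r_iB}$ if $r_iB<B$; $\tau_ix_B=x_{r_iB}-mx_B$ if $r_iB>B$. *)

(* Defs.v *)
From HB Require Import structures.
From mathcomp Require Import all_boot all_order all_algebra.
From mathcomp Require Import finmap.
Set Implicit Arguments. Unset Strict Implicit. Unset Printing Implicit Defensive.
Import Order.TTheory GRing.Theory Num.Theory.
Local Open Scope fset_scope.
Local Open Scope ring_scope.

Section Coxeter.
Variable n : nat.
Variable adj : rel 'I_n.

Definition simply_laced_diagram := symmetric adj /\ irreflexive adj.

Definition gram : 'M[int]_n :=
  \matrix_(i, j) (if i == j then 2 else if adj i j then -1 else 0).

(* Spherical (finite Weyl group): the invariant form is positive definite;
   for simply laced diagrams this means every component is of type A, D, E. *)
Definition spherical :=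
  forall x : 'rV[rat]_n, x != 0 ->
    0 < (x *m map_mx (fun z : int => z%:~R) gram *m x^T) 0 0.

(* Vectors in the root lattice, in coordinates w.r.t. the fundamental roots. *)
Notation vec := 'rV[int]_n.
Definition ip (x y : vec) : int := (x *m gram *m y^T) 0 0.
Definition alpha (i : 'I_n) : vec := delta_mx 0 i.
Definition refl (i : 'I_n) (x : vec) : vec := x - ip x (alpha i) *: alpha i.
(* the word [:: j1; ...; jk] denotes w = r_j1 ... r_jk *)
Definition act (w : seq 'I_n) (x : vec) : vec := foldr refl x w.
Definition root (x : vec) := exists (w : seq 'I_n) (i : 'I_n), x = act w (alpha i).
Definition posvec (x : vec) : bool := [forall j, 0 <= x 0 j].
Definition posroot (x : vec) := root x /\ posvec x.

Definition orth_posroots (B : {fset vec}) :=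
  (forall b, b \in B -> posroot b) /\
  (forall b c, b \in B -> c \in B -> b != c -> ip b c = 0).

(* wB = Phi^+ cap {+- w beta : beta in B}; all +- w beta are roots, so
   intersecting with Phi^+ amounts to keeping the nonnegative ones. *)
Definition actB (w : seq 'I_n) (B : {fset vec}) : {fset vec} :=
  [fset y in ([fset act w b | b in B] `|` [fset - act w b | b in B])%fset | posvec y].

Definition perpB (B : {fset vec}) (x : vec) : bool := all (fun b => ip x b == 0) B.

Definition Worbit (B1 B : {fset vec}) := exists w : seq 'I_n, B = actB w B1.

Definition admissible (B1 : {fset vec}) :=
  forall B, Worbit B1 B ->
  forall i j : 'I_n, i != j -> ~~ adj i j ->
  forall g : vec, g \in B -> g - alpha i + alpha j \in B ->
  actB [:: i] B = actB [:: j] B.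

Definition strict_porder_on (P : {fset vec} -> Prop) (lt : rel {fset vec}) :=
  (forall B, P B -> ~~ lt B B) /\
  (forall B C D, P B -> P C -> P D -> lt B C -> lt C D -> lt B D).
Definition maximal_in (P : {fset vec} -> Prop) (lt : rel {fset vec}) B :=
  P B /\ forall C, P C -> ~~ lt B C.
Definition unique_maximal (P : {fset vec} -> Prop) (lt : rel {fset vec}) B0 :=
  maximal_in P lt B0 /\ forall B, maximal_in P lt B -> B = B0.

Definition F := {fraction {poly rat}}.
Definition mF : F := @FracField.tofrac _ ('X : {poly rat}).

(* Expressions in the group algebra Q(m)[A]: scalars, generators s_i and
   their inverses, sums and products. *)
Inductive hterm :=
| HK of F
| HS of 'I_n
| HSi of 'I_n
| HAdd of hterm & hterm
| HMul of hterm & hterm.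

Fixpoint heval (R : algType F) (T Ti : 'I_n -> R) (t : hterm) : R :=
  match t with
  | HK c => c%:A
  | HS i => T i
  | HSi i => Ti i
  | HAdd t u => heval T Ti t + heval T Ti u
  | HMul t u => heval T Ti t * heval T Ti u
  end.

Definition hecke_rels (R : algType F) (T Ti : 'I_n -> R) :=
  (forall i, T i * Ti i = 1 /\ Ti i * T i = 1) /\
  (forall i j, adj i j -> T i * T j * T i = T j * T i * T j) /\
  (forall i j, i != j -> ~~ adj i j -> T i * T j = T j * T i) /\
  (forall i, T i * T i = 1 - mF *: T i).

(* equality of the images in H (H is the universal such algebra) *)
Definition hecke_eq (t u : hterm) :=
  forall (R : algType F) (T Ti : 'I_n -> R), hecke_rels T Ti ->
    heval T Ti t = heval T Ti u.

Fixpoint in_Z (C : pred 'I_n) (t : hterm) : bool :=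
  match t with
  | HK _ => true
  | HS i => C i
  | HSi _ => false
  | HAdd t u => in_Z C t && in_Z C u
  | HMul t u => in_Z C t && in_Z C u
  end.

Definition hword (v : seq 'I_n) : hterm := foldr (fun j t => HMul (HS j) t) (HK 1) v.
Definition hinvword (v : seq 'I_n) : hterm := foldl (fun t j => HMul (HSi j) t) (HK 1) v.
Definition conj_term (v : seq 'I_n) (i : 'I_n) : hterm :=
  HMul (hinvword v) (HMul (HS i) (hword v)).

Section Vsets.
Variables (P : {fset vec} -> Prop) (lt : rel {fset vec}) (B0 : {fset vec}).
Inductive Vset : {fset vec} -> 'I_n -> seq 'I_n -> Prop :=
| Vset_base i : perpB B0 (alpha i) -> Vset B0 i [::]
| Vset_nadj B i j v : P B -> perpB B (alpha i) ->
    lt B (actB [:: j] B) -> j != i -> ~~ adj j i ->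
    Vset (actB [:: j] B) i v -> Vset B i (j :: v)
| Vset_adj B i j v : P B -> perpB B (alpha i) ->
    lt B (actB [:: j] B) -> adj j i ->
    Vset (actB [:: i] (actB [:: j] B)) j v -> Vset B i (j :: i :: v).
End Vsets.

(* An element of V is a formal sum  sum_k x_{B_k} z_k,  given as a list of
   pairs (B_k, z_k). *)
Definition velem := seq ({fset vec} * hterm).

Definition tau_basis (lt : rel {fset vec}) (h : {fset vec} -> 'I_n -> hterm)
    (i : 'I_n) (B : {fset vec}) (z : hterm) : velem :=
  if alpha i \in B then [::]
  else if perpB B (alpha i) then [:: (B, HMul (h B i) z)]
  else if lt (actB [:: i] B) B then [:: (actB [:: i] B, z)]
  else if lt B (actB [:: i] B) then [:: (actB [:: i] B, z); (B, HMul (HK (- mF)) z)]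
  else [::].

Definition tau lt h i (s : velem) : velem :=
  flatten [seq tau_basis lt h i p.1 p.2 | p <- s].

Definition tau_word lt h (u : seq 'I_n) (s : velem) : velem :=
  foldr (tau lt h) s u.

Definition coef (B : {fset vec}) (s : velem) : hterm :=
  foldr (fun p t => if p.1 == B then HAdd p.2 t else t) (HK 0) s.

(* equality in V (coefficients compared in Z, a subalgebra of H) *)
Definition veq (s1 s2 : velem) := forall B, hecke_eq (coef B s1) (coef B s2).

(* the congruence on words defining the Artin monoid A^+ *)
Inductive braid_eq : seq 'I_n -> seq 'I_n -> Prop :=
| braid_refl u : braid_eq u u
| braid_sym u v : braid_eq u v -> braid_eq v u
| braid_trans u v w : braid_eq u v -> braid_eq v w -> braid_eq u w
| braid_adj u v i j : adj i j ->
    braid_eq (u ++ [:: i; j; i] ++ v) (u ++ [:: j; i; j] ++ v)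
| braid_comm u v i j : i != j -> ~~ adj i j ->
    braid_eq (u ++ [:: i; j] ++ v) (u ++ [:: j; i] ++ v).

End Coxeter.

(* Main.v *)
(** Order the orbit by [B < C] when the lowest root (by height) in which they
    differ lies in [B].  Then [B < r_i B] iff some [b] in [B] with
    [(b, alpha_i) = -1] has [g - b - alpha_i] positive for every [g] in [B]
    with [(g, alpha_i) = 1]; these differences are roots, hence never of
    height 0, which gives comparability.  Since positivity of a root is kept by
    simple reflections other than its own, the direction of [i] at [B] is that
    of [w i] at [w B] whenever [w alpha_i] is simple; admissibility handles the
    one exception, which occurs for [i], [j] not adjacent.  So every
    [<r_i, r_j>]-orbit is a point, an edge, a square, a 3-chain, a V or the
    weak order hexagon of [S_3].  Newman's lemma then yields a unique local
    maximum [B0], and a similar confluence argument shows that [v] in [V(B,i)]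
    satisfies [s_i v = v s_k] with [k] depending only on [(B,i)].  Thus
    [h_{B,i} = s_k], and the braid relations are checked on each type of orbit,
    on functionals rather than on elements of the module. *)

Require Import Defs.
From HB Require Import structures.
From mathcomp Require Import all_boot all_order all_algebra.
From mathcomp Require Import finmap.
From mathcomp Require Import zify ring ssrAC.
From Stdlib Require Import ClassicalEpsilon.
Set Implicit Arguments. Unset Strict Implicit. Unset Printing Implicit Defensive.
Import Order.TTheory GRing.Theory Num.Theory.
Local Open Scope fset_scope.
Local Open Scope ring_scope.

Lemma trmx11 (R : Type) (A : 'M[R]_1) : A^T = A.
Proof. by apply/matrixP => i j; rewrite mxE !ord1. Qed.

(* Locked, as is [ltB]: otherwise [done] unfolds [actB] when it compares sets. *)
HB.lock Definition rset n (adj : rel 'I_n) (i : 'I_n) (B : {fset 'rV[int]_n}) :=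
  actB adj [:: i] B.

Definition ht n (x : 'rV[int]_n) : int := \sum_k x 0 k.

(** Two sets whose exclusive elements start at the same height are incomparable, so this is only a
    partial order. Between [B] and [r i B] such a tie never occurs. *)
HB.lock Definition ltB n (B C : {fset 'rV[int]_n}) : bool :=
  has (fun b => all (fun c => ht b < ht c) (C `\` B)) (B `\` C).

(** * Vectors of norm 2 in the root lattice *)

Section Lattice.
Variables (n : nat) (adj : rel 'I_n).
Hypotheses (adj_sym : symmetric adj) (adj_irr : irreflexive adj).
Hypothesis sph : spherical adj.

Local Notation vec := 'rV[int]_n.
Local Notation ip := (ip adj).
Local Notation refl := (refl adj).

Lemma ipDl x y z : ip (x + y) z = ip x z + ip y z.
Proof. by rewrite /Defs.ip !mulmxDl mxE. Qed.

Lemma ipNl x z : ip (- x) z = - ip x z.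
Proof. by rewrite /Defs.ip !mulNmx mxE. Qed.

Lemma ipZl c x z : ip (c *: x) z = c * ip x z.
Proof. by rewrite /Defs.ip -!scalemxAl mxE. Qed.

Lemma ipC x y : ip x y = ip y x.
Proof.
rewrite /Defs.ip -[x *m _ *m _]trmx11 !trmx_mul trmxK mulmxA.
congr ((_ *m _ *m _) _ _); apply/matrixP => i j.
by rewrite !mxE eq_sym adj_sym.
Qed.

Lemma ipDr x y z : ip z (x + y) = ip z x + ip z y.
Proof. by rewrite ipC ipDl !(ipC z). Qed.

Lemma ipNr x z : ip z (- x) = - ip z x.
Proof. by rewrite ipC ipNl (ipC z). Qed.

Lemma ipZr c x z : ip z (c *: x) = c * ip z x.
Proof. by rewrite ipC ipZl (ipC z). Qed.

Definition ipE := (ipDl, ipDr, ipNl, ipNr, ipZl, ipZr).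

Lemma ip0l x : ip 0 x = 0.
Proof. by rewrite /Defs.ip !mul0mx mxE. Qed.

Lemma ip_alpha i j :
  ip (alpha i) (alpha j) = if i == j then 2 else if adj i j then -1 else 0.
Proof. by rewrite /Defs.ip /alpha -rowE trmx_delta -colE !mxE. Qed.

Lemma ip_alphaii i : ip (alpha i) (alpha i) = 2.
Proof. by rewrite ip_alpha eqxx. Qed.

Lemma adj_neq i j : adj i j -> i != j.
Proof. by move=> aij; apply/eqP => eij; rewrite eij adj_irr in aij. Qed.

Lemma ip_alpha_adj i j : adj i j -> ip (alpha i) (alpha j) = -1.
Proof. by move=> aij; rewrite ip_alpha (negbTE (adj_neq aij)) aij. Qed.

Lemma ip_alpha_nadj i j : i != j -> ~~ adj i j -> ip (alpha i) (alpha j) = 0.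
Proof. by rewrite ip_alpha => /negbTE -> /negbTE ->. Qed.

Lemma ip_gt0 x : x != 0 -> 0 < ip x x.
Proof.
move=> x0; pose f := (fun z : int => z%:~R : rat).
have fx0 : map_mx f x != 0.
  apply: contraNneq x0 => /rowP fx; apply/eqP/rowP => k.
  by have := fx k; rewrite !mxE => /eqP; rewrite intr_eq0 => /eqP.
have := sph fx0; rewrite -(@ltr_int rat) -/f.
suff -> : (map_mx f x *m map_mx f (gram adj) *m (map_mx f x)^T) 0 0
          = (ip x x)%:~R by [].
by rewrite matrix.map_trmx -!(map_mxM (intmul (1 : rat))) mxE.
Qed.

Lemma ip_eq0 x : ip x x = 0 -> x = 0.
Proof. by move=> h; apply/eqP; apply/negP => /negP/ip_gt0; rewrite h ltxx. Qed.

Lemma vec_sum_alpha (x : vec) : x = \sum_k x 0 k *: alpha k.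
Proof. exact: row_sum_delta. Qed.

(** Fundamental roots have norm 2 and the cross terms of a sum come twice, so the lattice is even.
    With definiteness, 2 is the least nonzero norm. *)
Lemma ip_even x : exists c : int, ip x x = 2 * c.
Proof.
rewrite (vec_sum_alpha x).
elim/big_ind: _ => [|y z [c hc] [d hd]|k _].
- by exists 0; rewrite ip0l mulr0.
- by exists (c + d + ip y z); rewrite !ipE hc hd (ipC z y); lia.
- by exists (x 0 k * x 0 k); rewrite !ipE ip_alphaii; lia.
Qed.

Lemma ip_ge2 x : x != 0 -> 2 <= ip x x.
Proof. by move=> /ip_gt0; case: (ip_even x) => c ->; lia. Qed.

(** Roots enter only through the property [ip x x = 2]; that every such
    vector is nonnegative or nonpositive replaces the usual theory. *)
Definition norm2 (x : vec) := ip x x = 2.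

Lemma norm2_alpha i : norm2 (alpha i). Proof. exact: ip_alphaii. Qed.

Lemma norm2N x : norm2 x -> norm2 (- x).
Proof. by rewrite /norm2 !ipE opprK. Qed.

Lemma norm2_neq0 x : norm2 x -> x != 0.
Proof. by move=> h; apply/eqP => x0; move: h; rewrite x0 /norm2 ip0l. Qed.

Lemma ip_sum_sum (f g : 'I_n -> int) :
  ip (\row_k f k) (\row_k g k) = \sum_k \sum_l f l * gram adj l k * g k.
Proof.
rewrite /Defs.ip mxE; apply: eq_bigr => k _.
rewrite !mxE mulr_suml; apply: eq_bigr => l _.
by rewrite !mxE.
Qed.

(** Split [x = p - q] into positive and negative parts. Their supports are disjoint and the
    off-diagonal Gram entries are at most 0, so [ip p q <= 0]. If both parts were nonzero, the norm
    of [x] would be at least 2 + 2. *)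
Lemma norm2_sign x : norm2 x -> posvec x || posvec (- x).
Proof.
move=> nx; set p : vec := \row_k Num.max (x 0 k) 0.
set q : vec := \row_k Num.max (- x 0 k) 0.
have xpq : x = p - q by apply/rowP => k; rewrite !mxE; lia.
have pq : ip p q <= 0.
  rewrite ip_sum_sum; apply: sumr_le0 => k _; apply: sumr_le0 => l _.
  have a0 (a : int) : 0 <= Num.max a 0 by lia.
  rewrite mxE; have [->|_] := eqVneq l k.
    by have [h|h] := leP (x 0 k) 0; have [h'|h'] := leP (- x 0 k) 0; lia.
  move: (a0 (x 0 l)) (a0 (- x 0 k)); move: (Num.max _ _) (Num.max _ _) => u v.
  by case: ifP => _; nia.
have max0 (a : int) : Num.max a 0 = 0 -> a <= 0 by move=> <-; rewrite le_max lexx.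
have [p0|p0] := eqVneq p 0.
  apply/orP; right; apply/forallP => k; rewrite mxE oppr_ge0; apply: max0.
  by have := congr1 (fun y : vec => y 0 k) p0; rewrite !mxE.
have [q0|q0] := eqVneq q 0.
  apply/orP; left; apply/forallP => k; rewrite -oppr_le0; apply: max0.
  by have := congr1 (fun y : vec => y 0 k) q0; rewrite !mxE.
have := ip_ge2 p0; have := ip_ge2 q0.
by move: nx; rewrite /norm2 {1 2}xpq !ipE (ipC q p); lia.
Qed.

Lemma htD (x y : vec) : ht (x + y) = ht x + ht y.
Proof. by rewrite /ht -big_split; apply: eq_bigr => k _; rewrite mxE. Qed.

Lemma htZ c (x : vec) : ht (c *: x) = c * ht x.
Proof. by rewrite /ht mulr_sumr; apply: eq_bigr => k _; rewrite mxE. Qed.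

Lemma htN (x : vec) : ht (- x) = - ht x.
Proof. by rewrite -scaleN1r htZ mulN1r. Qed.

Lemma ht_alpha (i : 'I_n) : ht (alpha i) = 1.
Proof.
rewrite /ht (bigD1 i) //= big1 ?addr0; first by rewrite mxE !eqxx.
by move=> k /negbTE ki; rewrite mxE ki andbF.
Qed.

Definition htE := (htD, htN, htZ, ht_alpha).

Lemma posvec_ht (x : vec) : posvec x -> x != 0 -> 0 < ht x.
Proof.
move=> /forallP px x0; rewrite lt_neqAle sumr_ge0 // andbT.
apply: contraNneq x0 => /esym/eqP; rewrite psumr_eq0 // => /allP h.
by apply/eqP/rowP => k; rewrite mxE; apply/eqP/h; rewrite mem_index_enum.
Qed.

Lemma posvecE x : norm2 x -> posvec x = (0 < ht x).
Proof.
move=> nx; have x0 := norm2_neq0 nx; apply/idP/idP => [px|hx].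
  exact: posvec_ht.
have /orP[//|px] := norm2_sign nx.
have := posvec_ht px; rewrite oppr_eq0 htN => /(_ x0); lia.
Qed.

Lemma norm2_ht x : norm2 x -> ht x != 0.
Proof.
move=> nx; have /orP[] := norm2_sign nx; first by rewrite posvecE //; lia.
by rewrite posvecE ?htN; [lia | exact: norm2N].
Qed.

(** Otherwise [x - y] is nonzero of norm [4 - 2 * ip x y <= 0]. *)
Lemma ip2_eq x y : norm2 x -> norm2 y -> 2 <= ip x y -> x = y.
Proof.
move=> nx ny xy; apply/eqP; rewrite -subr_eq0; apply/negP => /negP/ip_ge2.
by rewrite !ipE (ipC y x) nx ny; lia.
Qed.

Lemma ip_refl i x y : ip (refl i x) (refl i y) = ip x y.
Proof. by rewrite /Defs.refl !ipE ip_alphaii (ipC (alpha i) y); lia. Qed.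

Lemma reflK i : involutive (refl i).
Proof.
by move=> x; apply/rowP => k; rewrite /Defs.refl !ipE ip_alphaii !mxE; ring.
Qed.

Lemma ip_reflC i x y : ip (refl i x) y = ip x (refl i y).
Proof. by rewrite -[in RHS](ip_refl i) reflK. Qed.

Lemma reflN i x : refl i (- x) = - refl i x.
Proof. by rewrite /Defs.refl ipNl scaleNr opprB opprK addrC. Qed.

Lemma reflD i x y : refl i (x + y) = refl i x + refl i y.
Proof. by rewrite /Defs.refl ipDl scalerDl opprD addrACA. Qed.

Lemma reflB i x y : refl i (x - y) = refl i x - refl i y.
Proof. by rewrite reflD reflN. Qed.

Lemma norm2_refl i x : norm2 x -> norm2 (refl i x).
Proof. by rewrite /norm2 ip_refl. Qed.

Lemma refl_fix i x : ip x (alpha i) = 0 -> refl i x = x.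
Proof. by rewrite /Defs.refl => ->; rewrite scale0r subr0. Qed.

Lemma refl_alpha i : refl i (alpha i) = - alpha i.
Proof.
rewrite /Defs.refl ip_alphaii -{1}[alpha i]scale1r -scalerBl.
by rewrite (_ : 1 - 2 = -1) // scaleN1r.
Qed.

Lemma refl_alpha_adj i j : adj i j -> refl i (alpha j) = alpha i + alpha j.
Proof.
by move=> aij; rewrite /Defs.refl ipC ip_alpha_adj // scaleN1r opprK addrC.
Qed.

Lemma refl_alpha_nadj i j : i != j -> ~~ adj i j -> refl i (alpha j) = alpha j.
Proof. by move=> ij aij; rewrite refl_fix // ipC ip_alpha_nadj. Qed.

Lemma refl_refl_alpha i j : adj i j -> refl i (refl j (alpha i)) = alpha j.
Proof.
move=> aij; rewrite refl_alpha_adj 1?adj_sym // reflD refl_alpha.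
by rewrite refl_alpha_adj // addrAC subrr add0r.
Qed.

Lemma refl_comm i j x : i != j -> ~~ adj i j ->
  refl i (refl j x) = refl j (refl i x).
Proof.
move=> ij aij; rewrite /Defs.refl !ipE (ipC (alpha j)) ip_alpha_nadj //.
by rewrite !mulr0 !subr0 addrAC.
Qed.

Lemma refl_braid i j x : adj i j ->
  refl i (refl j (refl i x)) = refl j (refl i (refl j x)).
Proof.
move=> aij; apply/rowP => k.
rewrite /Defs.refl !ipE !ip_alphaii (ipC (alpha j)) !ip_alpha_adj // !mxE; ring.
Qed.

(** The reflection changes only coordinate [i]. If the image were negative, all other coordinates of
    [x] would vanish, and norm 2 would force [x = alpha i]. *)
Lemma ht_refl i x : norm2 x -> 0 < ht x -> x != alpha i -> 0 < ht (refl i x).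
Proof.
move=> nx; rewrite -posvecE // => /forallP px xi.
have nr := norm2_refl i nx; have /orP[|/forallP h] := norm2_sign nr.
  by rewrite posvecE.
suff /eqP E : x == x 0 i *: alpha i.
  move: nx; rewrite /norm2 {1 2}E !ipE ip_alphaii => e.
  have x1 : x 0 i = 1 by have := px i; nia.
  by case/eqP: xi; rewrite E x1 scale1r.
apply/eqP/rowP => k; rewrite !mxE eqxx /=.
have [->|ki] := eqVneq k i; first by rewrite mulr1.
have := h k; rewrite !mxE eqxx (negbTE ki) /= !mulr0 oppr0 addr0.
by have := px k; lia.
Qed.

Lemma ht_refl_ip i x : norm2 x -> 0 < ht x -> ip x (alpha i) != 2 ->
  0 < ht x - ip x (alpha i).
Proof.
move=> nx hx xi; have := @ht_refl i _ nx hx; rewrite /Defs.refl !htE mulr1.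
by apply; apply: contra_neq xi => ->; rewrite ip_alphaii.
Qed.

(** The sum of the three fundamental roots would have norm 6 - 6 = 0, hence be 0, yet its height is
    3. *)
Lemma no_triangle i j k : adj i j -> adj i k -> ~~ adj j k.
Proof.
move=> aij aik; apply/negP => ajk.
have z : ip (alpha i + alpha j + alpha k) (alpha i + alpha j + alpha k) = 0.
  rewrite !ipE !ip_alphaii (ipC (alpha j) (alpha i)) (ipC (alpha k) (alpha i)).
  by rewrite (ipC (alpha k) (alpha j)) !ip_alpha_adj.
have := congr1 (@ht n) (ip_eq0 z).
by rewrite !htE /ht big1 // => l _; rewrite mxE.
Qed.

(** Each coordinate is the product with a fixed rational vector, so Cauchy-Schwarz bounds it. The
    finiteness obtained here makes induction along the order possible. *)
Lemma norm2_bound : exists N : nat, forall x : vec, norm2 x ->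
  forall i, `|x 0 i| <= N%:Z.
Proof.
pose f := (fun z : int => z%:~R : rat).
pose G := map_mx f (gram adj); pose q (x y : 'rV[rat]_n) := (x *m G *m y^T) 0 0.
have qDl x y z : q (x + y) z = q x z + q y z by rewrite /q !mulmxDl mxE.
have qZl c x z : q (c *: x) z = c * q x z by rewrite /q -!scalemxAl mxE.
have qC x y : q x y = q y x.
  rewrite /q -[x *m _ *m _]trmx11 !trmx_mul trmxK mulmxA.
  congr ((_ *m _ *m _) _ _); apply/matrixP => i j.
  by rewrite !mxE eq_sym adj_sym.
have qDr x y z : q z (x + y) = q z x + q z y by rewrite qC qDl !(qC z).
have qZr c x z : q z (c *: x) = c * q z x by rewrite qC qZl (qC z).
have q0 x : 0 <= q x x.
  by have [->|/sph/ltW //] := eqVneq x 0; rewrite /q !mul0mx mxE.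
have Gu : G \in unitmx.
  rewrite -row_free_unit; apply: inj_row_free => v vG.
  by apply/eqP/negP => /negP/sph; rewrite -/G vG mul0mx mxE ltxx.
(* The fundamental weight dual to [alpha i]: pairing with it reads off coordinate [i]. *)
pose om i : 'rV[rat]_n := (invmx G *m (delta_mx 0 i)^T)^T.
have qom x i : q x (om i) = x 0 i.
  by rewrite /q /om trmxK -mulmxA mulKVmx // trmx_delta -colE mxE.
exists (\sum_i Num.bound (2 * q (om i) (om i)))%N => x nx i.
pose y := map_mx f x; pose w := om i.
have qy : q y y = 2.
  rewrite /q /y matrix.map_trmx -!(map_mxM (intmul (1 : rat))) mxE.
  by rewrite -/(Defs.ip adj x x) nx.
have yi : q y w = f (x 0 i) by rewrite qom mxE.
have CS : f (x 0 i) ^+ 2 <= 2 * q w w.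
  have [w0|w0] := eqVneq w 0.
    by rewrite -yi {1}w0 {1}/q trmx0 mulmx0 mxE expr0n mulr_ge0.
  have qw : 0 < q w w := sph w0.
  (* The component of [y] orthogonal to [w] has nonnegative norm. *)
  have := q0 (y + (- (q y w / q w w)) *: w).
  rewrite !(qDl, qDr, qZl, qZr) qy (qC w y) yi; set c := f _ => h.
  rewrite -ler_pdivrMr // -subr_ge0; apply: le_trans h _; rewrite le_eqVlt.
  by apply/orP; left; apply/eqP; field; rewrite gt_eqF.
have xx : `|x 0 i| <= x 0 i ^+ 2 by nia.
apply: (le_trans xx); rewrite -(@ler_int rat).
apply: (@le_trans _ _ (Num.bound (2 * q w w))%:R).
  rewrite rmorphXn /=; apply: (le_trans CS); apply/ltW.
  by apply: le_lt_trans (archi_boundP _); rewrite ?mulr_ge0.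
by rewrite -pmulrn ler_nat (bigD1 i) //= leq_addr.
Qed.

(** * Sets of orthogonal positive roots *)

Local Notation r i B := (rset adj i B).
Local Notation perp B i := (perpB adj B (alpha i)).

Lemma rsetE i B : r i B = actB adj [:: i] B.
Proof. by rewrite rset.unlock. Qed.

(** The working form of [orth_posroots]: norm 2 and positive height stand in for being a positive
    root. *)
Definition orthoset (B : {fset vec}) :=
  (forall b, b \in B -> norm2 b /\ 0 < ht b) /\
  (forall b c, b \in B -> c \in B -> b != c -> ip b c = 0).

Lemma ip_act w x y : ip (act adj w x) (act adj w y) = ip x y.
Proof. by elim: w => //= i w IH; rewrite ip_refl. Qed.

Lemma orth_posroots_orthoset B : orth_posroots adj B -> orthoset B.
Proof.
move=> [pos orth]; split=> // b /pos[[w [i eb]] pb].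
have nb : norm2 b by rewrite /norm2 eb ip_act ip_alphaii.
by split=> //; rewrite -posvecE.
Qed.

Lemma actBP w B y : orthoset B -> reflect
  (exists2 b, b \in B & 0 < ht y /\ (y = act adj w b \/ y = - act adj w b))
  (y \in actB adj w B).
Proof.
move=> [nB _]; rewrite /actB !inE /=.
have nw b : b \in B -> norm2 (act adj w b).
  by move=> /nB[nb _]; rewrite /norm2 ip_act.
apply: (iffP andP) => [[/orP[]/imfsetP[b /= bB ->] py]|[b bB [hy e]]].
- by exists b => //; rewrite -posvecE; [split; [|left] | exact: nw].
- exists b => //; rewrite -posvecE; [by split; [|right] |exact/norm2N/nw].
- split; last by case: e => e; move: hy; rewrite -posvecE // e;
    [exact: nw | apply/norm2N/nw].
  by case: e => ->; rewrite ?(in_imfset _ _ bB) ?orbT.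
Qed.

Lemma orthoset_actB w B : orthoset B -> orthoset (actB adj w B).
Proof.
move=> gB; have [nB oB] := gB; split => [y|y z].
  move=> /(actBP _ _ gB)[b /nB[nb _] [hy e]]; split=> //.
  by case: e => ->; rewrite /norm2 ?ipNl ?ipNr ?opprK ip_act.
move=> /(actBP _ _ gB)[b bB [hy ey]] /(actBP _ _ gB)[c cB [hz ez]] yz.
suff bc : b != c.
  by case: ey => ->; case: ez => ->; rewrite ?ipNl ?ipNr ip_act oB ?oppr0.
apply: contraNneq yz => bc; move: ey ez hy hz.
by rewrite bc => -[] -> [] ->; rewrite ?eqxx // !htE; lia.
Qed.

Lemma orthoset_r i B : orthoset B -> orthoset (r i B).
Proof. by rewrite rsetE; exact: orthoset_actB. Qed.

Lemma eq_actB w w' B : act adj w =1 act adj w' -> actB adj w B = actB adj w' B.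
Proof.
move=> ww; rewrite /actB; apply/fsetP => y; rewrite !inE; congr (_ && _).
by congr (_ || _); apply/imfsetP/imfsetP => -[b bB ->]; exists b => //; rewrite ww.
Qed.

(** Normalising signs after every letter, or once at the end, selects the same positive vectors, so
    the action of a word is a composite of the maps [r i]. *)
Lemma actB_cons i w B : orthoset B -> actB adj (i :: w) B = r i (actB adj w B).
Proof.
move=> gB; rewrite rsetE; have gw := orthoset_actB w gB; have [nB _] := gB.
apply/fsetP => y; apply/(actBP _ _ gB)/(actBP _ _ gw) => -[b bB [hy e]].
  have nw : norm2 (act adj w b) by rewrite /norm2 ip_act; case: (nB _ bB).
  have [hb|hb] := ltP 0 (ht (act adj w b)).
    exists (act adj w b); last by split.
    by apply/(actBP _ _ gB); exists b => //; split=> //; left.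
  exists (- act adj w b).
    apply/(actBP _ _ gB); exists b => //; split; last by right.
    by have := norm2_ht nw; rewrite htN; lia.
  by split=> //; case: e => ->; rewrite /= reflN ?opprK; [right|left].
have /(actBP _ _ gB)[c cB [_ e']] := bB.
exists c => //; split=> //; move: e; rewrite /=.
by case: e' => ->; rewrite ?reflN ?opprK => -[]; [left|right|right|left].
Qed.

Lemma actB_nil B : orthoset B -> actB adj [::] B = B.
Proof.
move=> gB; have [nB _] := gB; apply/fsetP => y.
apply/(actBP _ _ gB)/idP => [[b bB [hy [->//|e]]]|yB].
  by have [_] := nB _ bB; move: hy; rewrite e htN /=; lia.
by exists y => //; split; [case: (nB _ yB)|left].
Qed.

Lemma rK i B : orthoset B -> r i (r i B) = B.
Proof.
move=> gB; rewrite [r i B]rsetE -(actB_cons _ _ gB) -[RHS](actB_nil gB).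
by apply: eq_actB => x /=; rewrite reflK.
Qed.

Lemma r_comm i j B : orthoset B -> i != j -> ~~ adj i j ->
  r i (r j B) = r j (r i B).
Proof.
move=> gB ij aij; rewrite [r i B]rsetE [r j B]rsetE -!(actB_cons _ _ gB).
by apply: eq_actB => x /=; rewrite refl_comm.
Qed.

Lemma r_braid i j B : orthoset B -> adj i j ->
  r i (r j (r i B)) = r j (r i (r j B)).
Proof.
move=> gB aij; rewrite [r i B]rsetE [r j B]rsetE -!(actB_cons _ _ gB).
by apply: eq_actB => x /=; rewrite refl_braid.
Qed.

Lemma ip_alpha_bound x i : norm2 x -> 0 < ht x -> x != alpha i ->
  -1 <= ip x (alpha i) <= 1.
Proof.
move=> nx hx xi; apply/andP; split.
  rewrite leNgt; apply/negP => h.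
  have e := @ip2_eq x (- alpha i) nx (norm2N (norm2_alpha i)).
  have : x = - alpha i by apply: e; rewrite ipNr; lia.
  by move=> e'; move: hx; rewrite e' !htE.
rewrite leNgt; apply/negP => h.
by case/eqP: xi; apply: ip2_eq (norm2_alpha i) _ => //; lia.
Qed.

Lemma rP i B y : orthoset B -> reflect
  (exists2 b, b \in B & 0 < ht y /\ (y = refl i b \/ y = - refl i b)) (y \in r i B).
Proof. by rewrite rsetE => gB; exact: (actBP [:: i] y gB). Qed.

Section Reflection.
Variables (B : {fset vec}) (gB : orthoset B).

Lemma refl_in_r i b : b \in B -> b != alpha i -> refl i b \in r i B.
Proof.
move=> bB bi; apply/(rP _ _ gB); exists b => //; split; last by left.
by have [nb hb] := gB.1 _ bB; exact: ht_refl.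
Qed.

Lemma alpha_in_r i : (alpha i \in r i B) = (alpha i \in B).
Proof.
apply/(rP _ _ gB)/idP => [[b bB [_ e]]|iB]; last first.
  exists (alpha i) => //; rewrite ht_alpha; split=> //=.
  by right; rewrite refl_alpha opprK.
have [nb hb] := gB.1 _ bB.
have : b = alpha i \/ b = - alpha i.
  case: e => e; move: (congr1 (refl i) e); rewrite ?reflN reflK refl_alpha.
    by right.
  by move/(congr1 (-%R)); rewrite !opprK; left.
by case=> e'; [rewrite -e' | move: hb; rewrite e' !htE].
Qed.

Lemma perp_r i x : perpB adj (r i B) x = perpB adj B (refl i x).
Proof.
apply/allP/allP => h b bB.
  rewrite ip_reflC; have [e|bi] := eqVneq b (alpha i); last exact/h/refl_in_r.
  by rewrite e refl_alpha ipNr oppr_eq0 h // alpha_in_r -e.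
have /(rP _ _ gB)[c /h cB [_ e]] := bB; rewrite ip_reflC in cB.
by case: e => ->; rewrite ?ipNr ?oppr_eq0.
Qed.
End Reflection.

(** * Raising and lowering *)

Lemma refl_of_r B i c : orthoset B -> c \in r i B -> c != alpha i -> refl i c \in B.
Proof.
by move=> gB cB ci; rewrite -[B](rK i gB); exact: refl_in_r (orthoset_r i gB) _ _ _ _.
Qed.

Lemma r_fix B i : orthoset B -> (alpha i \in B) || perp B i -> r i B = B.
Proof.
move=> gB fixB; have fixb b : b \in B -> b != alpha i -> refl i b = b.
  move=> bB bi; apply: refl_fix; case/orP: fixB => [iB|/allP/(_ _ bB)/eqP].
    exact: gB.2.
  by rewrite ipC.
apply/fsetP => c; have [->|ci] := eqVneq c (alpha i); first exact: alpha_in_r.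
apply/idP/idP => [cB|cB]; last by rewrite -(fixb c) //; exact: refl_in_r.
have rcB := refl_of_r gB cB ci; rewrite -[c](reflK i) (fixb _ rcB) //.
apply/eqP => e; have := ((orthoset_r i gB).1 _ cB).2.
by rewrite -[c](reflK i) e refl_alpha !htE.
Qed.

(** * The order and the direction of a reflection *)

Local Notation up i B := (ltB B (r i B)).

Lemma ltBP (B C : {fset vec}) : reflect
  (exists b, [/\ b \in B, b \notin C &
     forall c, c \in C -> c \notin B -> ht b < ht c])
  (ltB B C).
Proof.
rewrite ltB.unlock; apply: (iffP hasP) => [[b]|[b [bB bC h]]].
  rewrite inE => /andP[bC bB] /allP h; exists b; split=> // c cC cB.
  by apply: h; rewrite !inE cC cB.
exists b; first by rewrite !inE bB bC.
by apply/allP => c; rewrite !inE => /andP[cB cC]; exact: h.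
Qed.

Lemma ltB_irr (B : {fset vec}) : ~~ ltB B B.
Proof. by apply/ltBP => -[b [->]]. Qed.

(** The lower of the two witnesses still separates [B] from [D]. *)
Lemma ltB_trans (B C D : {fset vec}) : ltB B C -> ltB C D -> ltB B D.
Proof.
move=> /ltBP[x [xB xC hx]] /ltBP[y [yC yD hy]]; apply/ltBP.
have [xy|yx] := leP (ht x) (ht y).
  exists x; split=> //; first by apply/negP => xD; have := hy _ xD xC; lia.
  move=> c cD cB; have [cC|cC] := boolP (c \in C); first exact: hx.
  by have := hy _ cD cC; lia.
have yB : y \in B by apply/negPn/negP => yB; have := hx _ yC yB; lia.
exists y; split=> // c cD cB.
have [cC|cC] := boolP (c \in C); last exact: hy.
by have := hx _ cC cB; lia.
Qed.

Lemma ltB_asym (B C : {fset vec}) : ltB B C -> ltB C B -> False.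
Proof. by move=> h /(ltB_trans h); apply/negP/ltB_irr. Qed.

Lemma exists_min (s : seq vec) (P : pred vec) : has P s ->
  exists b, [/\ b \in s, P b & forall c, c \in s -> P c -> ht b <= ht c].
Proof.
elim: s => //= a s IH; have [Ps _|Ps] := boolP (has P s).
  have [b [bs Pb hb]] := IH Ps; have [Pa|Pa] := boolP (P a); last first.
    exists b; split; rewrite ?inE ?bs ?orbT // => c.
    by rewrite inE => /orP[/eqP-> /(negP Pa)//|]; exact: hb.
  have [ab|ba] := leP (ht a) (ht b).
    exists a; split; rewrite ?inE ?eqxx // => c.
    by rewrite inE => /orP[/eqP->//|cs Pc]; exact: le_trans (hb _ cs Pc).
  exists b; split; rewrite ?inE ?bs ?orbT // => c.
  by rewrite inE => /orP[/eqP-> _|]; [exact: ltW | exact: hb].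
rewrite orbF => Pa; exists a; split; rewrite ?inE ?eqxx // => c.
rewrite inE => /orP[/eqP->//|cs Pc]; case/negP: Ps.
by apply/hasP; exists c.
Qed.

Section Up.
Variables (B : {fset vec}) (i : 'I_n).
Hypothesis gB : orthoset B.

(** A moved root has product 2 - 1 = 1 with its image, which is impossible for two elements of an
    orthogonal set. *)
Lemma refl_notin b : b \in B -> `|ip b (alpha i)| = 1 -> refl i b \notin B.
Proof.
move=> bB b1; apply/negP => rB; have [nb _] := gB.1 _ bB.
have : ip b (refl i b) = 1 by rewrite /Defs.refl !ipE nb; nia.
have [e|ne] := eqVneq b (refl i b); first by rewrite -e nb.
by rewrite gB.2.
Qed.

Lemma notin_r b : b \in B -> `|ip b (alpha i)| = 1 -> b \notin r i B.
Proof.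
move=> bB b1; apply: contra (refl_notin bB b1) => bR; apply: refl_of_r => //.
by apply/eqP => e; rewrite e ip_alphaii in b1.
Qed.

Lemma moved_ip b : b \in B -> b \notin r i B -> `|ip b (alpha i)| = 1.
Proof.
move=> bB bR; have [nb hb] := gB.1 _ bB.
have bi : b != alpha i by apply: contraNneq bR => e; rewrite e alpha_in_r -?e.
have := ip_alpha_bound nb hb bi.
have [e|ne] := eqVneq (ip b (alpha i)) 0; last by lia.
by case/negP: bR; rewrite -(refl_fix e) refl_in_r.
Qed.

(** The norm is 6 - 2 - 2. By [norm2_ht] the height of this vector is nonzero, so [ht g] never
    equals [ht b + 1]: a rising and a falling root cannot tie. *)
Lemma ht_up_down b g : b \in B -> g \in B ->
  ip b (alpha i) = -1 -> ip g (alpha i) = 1 ->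
  norm2 (g - b - alpha i).
Proof.
move=> bB gB' bi gi; have [nb _] := gB.1 _ bB; have [ng _] := gB.1 _ gB'.
have bg : ip b g = 0.
  by apply: gB.2 => //; apply/eqP => e; rewrite e gi in bi.
by rewrite /norm2 !ipE ip_alphaii (ipC g b) !(ipC (alpha i)) bg bi gi nb ng.
Qed.

(** The reflection raises by one the elements with product -1 and lowers by one those with product
    1. So the lowest difference lies in [B] exactly when some rising [b] lies below the images, of
    height [ht g - 1], of all falling [g]. *)
Lemma upP : reflect
  (exists b, [/\ b \in B, ip b (alpha i) = -1 &
    forall g, g \in B -> ip g (alpha i) = 1 -> ht b + 1 < ht g])
  (up i B).
Proof.
apply: (iffP (ltBP _ _)) => [[b [bB bR hb]]|[b0 [b0B b0i h0]]].
  have b1 := moved_ip bB bR.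
  have neq_alpha c : `|ip c (alpha i)| = 1 -> c != alpha i.
    by move=> c1; apply/eqP => e; rewrite e ip_alphaii in c1.
  have hr c : c \in B -> `|ip c (alpha i)| = 1 -> ht b < ht c - ip c (alpha i).
    move=> cB c1; have := hb _ (refl_in_r gB cB (neq_alpha _ c1)) (refl_notin cB c1).
    by rewrite /Defs.refl !htE mulr1.
  have bi : ip b (alpha i) = -1 by have := hr _ bB b1; lia.
  exists b; split=> // g gB' gi; have := hr _ gB'; rewrite gi => /(_ erefl).
  by have := norm2_ht (ht_up_down bB gB' bi gi); rewrite !htE; lia.
have /exists_min[b [bB /eqP bi hb]] : has (fun b => ip b (alpha i) == -1) B.
  by apply/hasP; exists b0 => //; apply/eqP.
exists b; split=> //; first by apply: notin_r => //; rewrite bi.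
move=> c cR cB; have ci : c != alpha i.
  by apply: contraNneq cB => e; rewrite e -alpha_in_r -?e.
have gR := orthoset_r i gB; have rcB := refl_of_r gB cR ci.
have [nr _] := gB.1 _ rcB; have [nc hc] := gR.1 _ cR.
have := ip_alpha_bound nc hc ci.
have ri : ip (refl i c) (alpha i) = - ip c (alpha i).
  by rewrite ip_reflC refl_alpha ipNr.
have hrc : ht (refl i c) = ht c - ip c (alpha i) by rewrite /Defs.refl !htE mulr1.
have [e|ne] := eqVneq (ip c (alpha i)) 0.
  by case/negP: cB; rewrite -(refl_fix e).
have [e1 _|ne1] := eqVneq (ip c (alpha i)) 1.
  by have := hb _ rcB; rewrite ri hrc e1 eqxx => /(_ isT); lia.
move=> cb; have e1 : ip c (alpha i) = -1 by lia.
have := h0 _ rcB; rewrite ri hrc e1 => /(_ erefl).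
by have := hb _ b0B; rewrite b0i eqxx => /(_ isT); lia.
Qed.

End Up.

(** The condition [up i (r i B)] expresses that [i] descends at [B]. This is [upP] at [r i B], where
    rising and falling elements are exchanged. *)
Lemma dnP B i : orthoset B -> reflect
  (exists g, [/\ g \in B, ip g (alpha i) = 1 &
    forall b, b \in B -> ip b (alpha i) = -1 -> ht g < ht b + 1])
  (up i (r i B)).
Proof.
move=> gB; have gR := orthoset_r i gB.
have out (C : {fset vec}) c : orthoset C -> c \in C -> `|ip c (alpha i)| = 1 ->
    [/\ refl i c \in r i C, ip (refl i c) (alpha i) = - ip c (alpha i) &
        ht (refl i c) = ht c - ip c (alpha i)].
  move=> gC cC c1; split; last by rewrite /Defs.refl !htE mulr1.
    by apply: refl_in_r => //; apply/eqP => e; rewrite e ip_alphaii in c1.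
  by rewrite ip_reflC refl_alpha ipNr.
apply: (iffP (upP _ gR)) => -[x [xB xi hx]].
  have [|h1 h2 h3] := out _ x gR xB; first by rewrite xi.
  rewrite rK // xi in h1 h2 h3; exists (refl i x); split=> // b bB bi.
  have [|k1 k2 k3] := out _ b gB bB; first by rewrite bi.
  rewrite bi in k2 k3; have := hx _ k1 k2; lia.
have [|h1 h2 h3] := out _ x gB xB; first by rewrite xi.
rewrite xi in h2 h3; exists (refl i x); split=> // b bB bi.
have [|k1 k2 k3] := out _ b gR bB; first by rewrite bi.
rewrite rK // bi in k1 k2 k3; have := hx _ k1 k2; lia.
Qed.

(** Compare the lowest rising with the lowest falling element; [ht_up_down] excludes a tie. If only
    one kind occurs, it decides alone. *)
Lemma up_or_dn B i : orthoset B -> alpha i \notin B -> ~~ perp B i ->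
  up i B \/ up i (r i B).
Proof.
move=> gB iB; rewrite -has_predC => /hasP[b0 b0B /=]; rewrite ipC => b0i.
have [nb hb] := gB.1 _ b0B.
have ni : b0 != alpha i by apply: contraNneq iB => <-.
have bnd := ip_alpha_bound nb hb ni.
have [/exists_min[b [bB /eqP bi hbm]]|hU] :=
    boolP (has (fun b => ip b (alpha i) == -1) B); last first.
  right; apply/dnP => //; exists b0; split=> //.
    have ne : ip b0 (alpha i) != -1 by apply: contraNneq hU => e;
      apply/hasP; exists b0 => //; apply/eqP.
    lia.
  by move=> b bB bi; case/negP: hU; apply/hasP; exists b => //; apply/eqP.
have [/exists_min[g [gB' /eqP gi hgm]]|hD] :=
    boolP (has (fun b => ip b (alpha i) == 1) B); last first.
  left; apply/upP => //; exists b; split=> // g gB' gi.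
  by case/negP: hD; apply/hasP; exists g => //; apply/eqP.
have := norm2_ht (ht_up_down gB bB gB' bi gi); rewrite !htE => hne.
have [h|h] := ltP (ht b + 1) (ht g).
  left; apply/upP => //; exists b; split=> // c cB ci.
  by have := hgm _ cB; rewrite ci eqxx => /(_ isT); lia.
right; apply/dnP => //; exists g; split=> // c cB ci.
by have := hbm _ cB; rewrite ci eqxx => /(_ isT); lia.
Qed.

Lemma up_notin B i : orthoset B -> up i B -> alpha i \notin B.
Proof.
by move=> gB u; apply/negP => iB; move: u; rewrite r_fix ?iB // (negbTE (ltB_irr _)).
Qed.

Lemma up_nperp B i : orthoset B -> up i B -> ~~ perp B i.
Proof.
move=> gB u; apply/negP => iB; move: u.
by rewrite r_fix ?iB ?orbT // (negbTE (ltB_irr _)).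
Qed.

Lemma alpha_in_r_nadj B i j : orthoset B -> i != j -> ~~ adj i j ->
  (alpha i \in r j B) = (alpha i \in B).
Proof.
move=> gB ij aij; have e : refl j (alpha i) = alpha i.
  by rewrite refl_alpha_nadj 1?eq_sym // adj_sym.
have ne : alpha i != alpha j.
  by apply/eqP => h; have := ip_alpha_nadj ij aij; rewrite h ip_alphaii.
apply/idP/idP => h; rewrite -e; first exact: refl_of_r.
exact: refl_in_r.
Qed.

Lemma alpha_in_r_adj B i j : orthoset B -> adj i j ->
  (alpha i \in r j B) = (alpha i + alpha j \in B).
Proof.
move=> gB aij; have e : refl j (alpha i) = alpha i + alpha j.
  by rewrite refl_alpha_adj 1?adj_sym // addrC.
have ne : alpha i != alpha j.
  by apply/eqP => h; have := ip_alpha_adj aij; rewrite h ip_alphaii.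
apply/idP/idP => h; first by rewrite -e; exact: refl_of_r.
rewrite -[alpha i](reflK j) e; apply: refl_in_r => //.
by apply/eqP => h'; have := congr1 (@ht n) h'; rewrite !htE.
Qed.

Lemma perp_r_nadj B i j : orthoset B -> i != j -> ~~ adj i j ->
  perp (r j B) i = perp B i.
Proof. by move=> gB ij aij; rewrite perp_r // refl_alpha_nadj 1?eq_sym // adj_sym. Qed.

(** The product [r_i r_j] takes [alpha i] to [alpha j]. *)
Lemma perp_rr B i j : orthoset B -> adj i j -> perp (r i (r j B)) j = perp B i.
Proof.
move=> gB aij; rewrite !perp_r ?refl_refl_alpha 1?adj_sym //.
exact: orthoset_r.
Qed.

(** The product [r_i r_j] takes [d = g - b - alpha i] to the corresponding difference for [alpha j].
    It stays positive unless [d] is [alpha j] or [alpha i + alpha j]; but [d] is orthogonal to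
    [alpha i] and these two are not. *)
Lemma up_adj_transport B i j : orthoset B -> adj i j -> alpha j \notin B ->
  up i B -> up j (r i (r j B)).
Proof.
move=> gB aij jB /(upP i gB)[b [bB bi hb]].
have gj := orthoset_r j gB; have gij := orthoset_r i gj.
have ji : ip (alpha j) (alpha i) = -1 by rewrite ipC ip_alpha_adj.
have ij : ip (alpha i) (alpha j) = -1 by rewrite ip_alpha_adj.
have aji : adj j i by rewrite adj_sym.
have ipw x : ip (refl i (refl j x)) (alpha j) = ip x (alpha i).
  by rewrite !ip_reflC refl_refl_alpha.
have bj : b != alpha j by apply: contraNneq jB => <-.
have rbi : refl j b != alpha i.
  apply/eqP => /(congr1 (refl j)); rewrite reflK refl_alpha_adj // => e.
  by move: bi; rewrite e ipE ip_alphaii ji.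
apply/(upP j gij); exists (refl i (refl j b)); split.
- by apply: refl_in_r => //; exact: refl_in_r.
- by rewrite ipw.
move=> c cB cj; have ci : c != alpha i.
  by apply/eqP => e; move: cj; rewrite e ij.
have rcB := refl_of_r gj cB ci.
have rcj : refl i c != alpha j.
  by apply: contraNneq jB => e; rewrite -alpha_in_r // -e.
have gB' := refl_of_r gB rcB rcj; set g := refl j (refl i c) in gB'.
have ec : c = refl i (refl j g) by rewrite /g !reflK.
clearbody g; have gi : ip g (alpha i) = 1 by rewrite -ipw -ec.
have nd := ht_up_down gB bB gB' bi gi; pose d := g - b - alpha i; rewrite -/d in nd.
have di : ip d (alpha i) = 0 by rewrite /d !ipE bi gi ip_alphaii.
have hd : 0 < ht d by have := hb _ gB' gi; rewrite /d !htE; lia.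
have ed : refl i (refl j d) = c - refl i (refl j b) - alpha j.
  rewrite /d (reflB j (g - b) (alpha i)) (reflB j g b).
  rewrite (reflB i (refl j g - refl j b)) (reflB i (refl j g)).
  by rewrite -ec refl_refl_alpha.
suff : 0 < ht (refl i (refl j d)) by rewrite ed !htE; lia.
apply: ht_refl; [exact: norm2_refl | apply: ht_refl => // | ].
  by apply/eqP => e; move: di; rewrite e ji.
apply/eqP => /(congr1 (refl j)); rewrite reflK refl_alpha_adj // => e.
by move: di; rewrite e ipE ip_alphaii ji.
Qed.

(** Since [r i B = B], this is the transport of [up j B] along [r_j r_i]. *)
Lemma up_perp B i j : orthoset B -> adj i j -> perp B i -> up j B -> up i (r j B).
Proof.
move=> gB aij iB uj; have iB' : alpha i \notin B.
  by apply/negP => iB'; have /allP/(_ _ iB') := iB; rewrite ip_alphaii.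
rewrite -[in r j B](r_fix (i := i) gB) ?iB ?orbT //.
by apply: up_adj_transport; rewrite // adj_sym.
Qed.

(** Write [(x_i, x_j)] for the products of [x] with the two fundamental roots. In [r j B] the image
    of [x] has product [x_i + x_j] with [alpha i], so a witness must come from type [(-1, 0)] or
    [(0, -1)]. The witness [b] for [i] or the witness [c] for [j] has such a type and serves. *)
Lemma up_up_adj B i j : orthoset B -> adj i j -> up i B -> up j B -> up i (r j B).
Proof.
move=> gB aij ui uj; have iB := up_notin gB ui; have jB := up_notin gB uj.
have gj := orthoset_r j gB.
have /(upP i gB)[b [bB bi hb]] := ui; have /(upP j gB)[c [cB cj hc]] := uj.
have ji : ip (alpha j) (alpha i) = -1 by rewrite ipC ip_alpha_adj.
have ij : ip (alpha i) (alpha j) = -1 by rewrite ip_alpha_adj.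
have bnd x k : x \in B -> alpha k \notin B -> -1 <= ip x (alpha k) <= 1.
  move=> xB kB; have [nx hx] := gB.1 _ xB; apply: ip_alpha_bound => //.
  by apply: contraNneq kB => <-.
have bnd2 x : x \in B -> -1 <= ip x (alpha i) + ip x (alpha j).
  move=> xB; have [nx hx] := gB.1 _ xB; rewrite leNgt; apply/negP => h.
  have nij : norm2 (- (alpha i + alpha j)).
    by rewrite /norm2 !ipE !ip_alphaii ij ji.
  have := ip2_eq nx nij; rewrite !ipE => e.
  have {}e : x = - (alpha i + alpha j) by apply: e; lia.
  by move: hx; rewrite e !htE.
have ht_r x : ht (refl j x) = ht x - ip x (alpha j) by rewrite /Defs.refl !htE mulr1.
have ip_r x : ip (refl j x) (alpha i) = ip x (alpha i) + ip x (alpha j).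
  by rewrite ip_reflC refl_alpha_adj 1?adj_sym // ipDr addrC.
(* The competitors that fall under [r_i] after [r_j] are the images of the elements of types
   [(1, 0)] and [(0, 1)]. *)
have red x : x \in B -> ip x (alpha i) + ip x (alpha j) = -1 ->
    (forall g, g \in B ->
       ip g (alpha i) = 1 /\ ip g (alpha j) = 0 \/
       ip g (alpha i) = 0 /\ ip g (alpha j) = 1 ->
       ht x - ip x (alpha j) + 1 < ht g - ip g (alpha j)) ->
    up i (r j B).
  move=> xB xij hx; apply/(upP i gj); exists (refl j x); split.
  - by apply: refl_in_r => //; apply: contraNneq jB => <-.
  - by rewrite ip_r.
  move=> y yB yi; have yj : y != alpha j.
    by apply/eqP => e; move: yi; rewrite e ji.
  have gB' := refl_of_r gB yB yj; set g := refl j y in gB'.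
  have ey : y = refl j g by rewrite /g reflK.
  clearbody g.
  rewrite ey ip_r in yi; rewrite ey !ht_r; apply: hx => //.
  by have := bnd _ i gB' iB; have := bnd _ j gB' jB; lia.
(* The positive root [g - c - alpha j] can be lowered twice, by [r_i] and then [r_j], and stays
   positive; this gives the extra 2 in the bound. *)
have cown g : g \in B -> ip c (alpha i) = 0 ->
    ip g (alpha i) = 0 -> ip g (alpha j) = 1 -> ht c + 3 < ht g.
  move=> gB' ci gi gj1; have nd := ht_up_down gB cB gB' cj gj1.
  have hd : 0 < ht (g - c - alpha j) by have := hc _ gB' gj1; rewrite !htE; lia.
  have di : ip (g - c - alpha j) (alpha i) = 1 by rewrite !ipE ci gi ji.
  have := @ht_refl i _ nd hd; rewrite /Defs.refl di !htE => h1.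
  have {}h1 : 0 < ht (refl i (g - c - alpha j)).
    by apply: ht_refl => //; apply/eqP => e; move: di; rewrite e ip_alphaii.
  have dj : ip (refl i (g - c - alpha j)) (alpha j) = 1.
    by rewrite /Defs.refl di !ipE ip_alphaii gj1 cj ij.
  have := @ht_refl_ip j _ (norm2_refl i nd) h1; rewrite dj => /(_ isT).
  by rewrite /Defs.refl di !htE; lia.
have cx := hc _ bB; have bx := hb _ cB.
have bndb := bnd _ j bB jB; have bndc := bnd _ i cB iB.
have b2 := bnd2 _ bB; have c2 := bnd2 _ cB.
have useb : ip b (alpha j) = 0 ->
    (forall g, g \in B -> ip g (alpha i) = 0 -> ip g (alpha j) = 1 ->
       ht b + 2 < ht g) -> up i (r j B).
  move=> bj hg; apply: (red b bB); first by rewrite bi bj.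
  move=> g gB' [[gi gj1]|[gi gj1]]; rewrite bj gj1.
    by have := hb _ gB' gi; lia.
  by have := hg _ gB' gi gj1; lia.
have usec : ip c (alpha i) = 0 ->
    (forall g, g \in B -> ip g (alpha i) = 1 -> ip g (alpha j) = 0 ->
       ht c + 2 < ht g) -> up i (r j B).
  move=> ci hg; apply: (red c cB); first by rewrite ci cj.
  move=> g gB' [[gi gj1]|[gi gj1]]; rewrite cj gj1.
    by have := hg _ gB' gi gj1; lia.
  by have := cown _ gB' ci gi gj1; lia.
(* If both [b] and [c] qualify, the lower one is used. If neither does, each falls under the other
   reflection, and the two height inequalities contradict each other. *)
have [bj|bj] := eqVneq (ip b (alpha j)) 0; have [ci|ci] := eqVneq (ip c (alpha i)) 0.
- have [bc|cb] := leP (ht b) (ht c).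
    by apply: useb => // g gB' gi gj1; have := cown _ gB' ci gi gj1; lia.
  by apply: usec => // g gB' gi gj1; have := hb _ gB' gi; lia.
- by apply: useb => // g gB' gi gj1; have := hc _ gB' gj1; lia.
- by apply: usec => // g gB' gi gj1; have := hb _ gB' gi; lia.
- by lia.
Qed.

(** * The orbit and its maximum *)

Variable B1 : {fset vec}.
Hypothesis gB1 : orthoset B1.
Hypothesis admB1 : admissible adj B1.
Local Notation Ob := (Worbit adj B1).

Lemma orbit_orthoset B : Ob B -> orthoset B.
Proof. by case=> w ->; exact: orthoset_actB. Qed.
#[local] Hint Resolve orbit_orthoset : core.

Lemma orbit_r i B : Ob B -> Ob (r i B).
Proof. by case=> w ->; exists (i :: w); rewrite (actB_cons _ _ gB1). Qed.
#[local] Hint Resolve orbit_r : core.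

Lemma orbit_base : Ob B1.
Proof. by exists [::]; rewrite actB_nil. Qed.

Lemma orbit_ind_r (P : {fset vec} -> Prop) : P B1 ->
  (forall i B, Ob B -> P B -> P (r i B)) -> forall B, Ob B -> P B.
Proof.
move=> P1 PS B [w ->]; elim: w => [|i w IH]; first by rewrite actB_nil.
by rewrite (actB_cons _ _ gB1); apply: PS => //; exists w.
Qed.

(** Admissibility rules out the only case, [g - b - alpha i = alpha j],
    in which [r j] could reverse the comparison of [B] with [r i B]. *)
Lemma up_nadj B i j : Ob B -> i != j -> ~~ adj i j -> r i B <> r j B ->
  up i B -> up i (r j B).
Proof.
move=> oB ij aij rij /(upP i (orbit_orthoset oB))[b [bB bi hb]].
have gB := orbit_orthoset oB; have gj := orthoset_r j gB.
have ij0 : ip (alpha j) (alpha i) = 0 by rewrite ipC ip_alpha_nadj.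
have rji : refl j (alpha i) = alpha i by rewrite refl_alpha_nadj 1?eq_sym 1?adj_sym.
have ipr x : ip (refl j x) (alpha i) = ip x (alpha i) by rewrite ip_reflC rji.
apply/(upP i gj); exists (refl j b); split; last 1 first.
- move=> c cB ci; have cj : c != alpha j.
    by apply/eqP => e; move: ci; rewrite e ij0.
  have gB' := refl_of_r gB cB cj; set g := refl j c in gB'.
  have ec : c = refl j g by rewrite /g reflK.
  clearbody g; have gi : ip g (alpha i) = 1 by rewrite -ipr -ec.
  have nd := ht_up_down gB bB gB' bi gi; pose d := g - b - alpha i.
  have hd : 0 < ht d.
    by have := hb _ gB' gi; rewrite /d !htE; lia.
  have ed : refl j d = c - refl j b - alpha i.
    by rewrite /d (reflB j (g - b)) (reflB j g) -ec rji.
  suff : 0 < ht (refl j d) by rewrite ed !htE; lia.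
  (* If [d = alpha j], then [b + alpha i] and [r_i g = b + alpha j] both lie in [r i B].
     Admissibility at [r i B] gives [B = r j (r i B)], against [r i B <> r j B]. *)
  apply: ht_refl => //; apply/eqP => dj; case: rij.
  have neq x : `|ip x (alpha i)| = 1 -> x != alpha i.
    by move=> x1; apply/eqP => e; rewrite e ip_alphaii in x1.
  have b1 : b + alpha i \in r i B.
    have -> : b + alpha i = refl i b by rewrite /Defs.refl bi scaleN1r opprK.
    by apply: refl_in_r => //; apply: neq; rewrite bi.
  have b2 : b + alpha i - alpha i + alpha j \in r i B.
    have -> : b + alpha i - alpha i + alpha j = refl i g.
      by rewrite -dj /d /Defs.refl gi scale1r addrK addrA addrCA subrr addr0.
    by apply: refl_in_r => //; apply: neq; rewrite gi.
  have := admB1 (orbit_r i oB) ij aij b1 b2; rewrite -!rsetE rK // => eB.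
  by rewrite {2}eB rK //; exact: orthoset_r.
- apply: refl_in_r => //; apply/eqP => e; move: bi; rewrite e ij0; lia.
- by rewrite ipr.
Qed.

Lemma dn_nadj B i j : Ob B -> i != j -> ~~ adj i j -> r i B <> r j B ->
  up i (r i B) -> up i (r i (r j B)).
Proof.
move=> oB ij aij rij ui; rewrite r_comm //; last exact: orbit_orthoset.
apply: up_nadj => //; first exact: orbit_r.
rewrite rK //; last exact: orbit_orthoset.
move=> eB; case: rij; rewrite {2}eB rK //.
by apply: orthoset_r; exact: orbit_orthoset.
Qed.

(** Induction from above. All orbit elements are subsets of a finite box [S], and the number [mu] of
    subsets of [S] above [B] drops when [B] grows. *)
Lemma orbit_wf (P : {fset vec} -> Prop) :
  (forall B, Ob B -> (forall C, Ob C -> ltB B C -> P C) -> P B) ->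
  forall B, Ob B -> P B.
Proof.
move=> step; have [N hN] := norm2_bound.
pose vec_of (f : {ffun 'I_n -> 'I_N.+1}) : vec := \row_k (f k : nat)%:Z.
pose S : {fset vec} := [fset vec_of f | f in {: {ffun 'I_n -> 'I_N.+1}}].
have inS B : Ob B -> B \in fpowerset S.
  move=> /orbit_orthoset gB; rewrite fpowersetE; apply/fsubsetP => b bB.
  have [nb] := gB.1 _ bB; rewrite -posvecE // => /forallP b0.
  apply/imfsetP; exists [ffun k => inord (absz (b 0%R k))] => //.
  apply/rowP => k; rewrite mxE ffunE inordK; first by rewrite gez0_abs.
  by rewrite ltnS -lez_nat abszE; exact: hN.
pose mu B := #|` [fset C in fpowerset S | ltB B C]|.
have mu_lt B C : Ob B -> Ob C -> ltB B C -> (mu C < mu B)%N.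
  move=> oB oC BC; apply: fproper_ltn_card; rewrite fproperE; apply/andP; split.
    apply/fsubsetP => D; rewrite !inE => /andP[h CD].
    by rewrite (ltB_trans BC CD) andbT.
  apply/fsubsetPn; exists C; rewrite !inE /=; first by rewrite inS.
  by rewrite (negbTE (ltB_irr C)) andbF.
have H m : forall B, Ob B -> (mu B < m)%N -> P B.
  elim: m => // m IH B oB Bm; apply: step => // C oC BC; apply: IH => //.
  exact: leq_trans (mu_lt _ _ oB oC BC) _.
by move=> B oB; apply: (H (mu B).+1).
Qed.

(** * Ascending chains and their common end *)

Definition top (B : {fset vec}) := [forall j, ~~ up j B].

(** Some chain of ascents from the first set stops at the second, a local maximum. *)
Inductive climbs : {fset vec} -> {fset vec} -> Prop :=
| climbs_top B : top B -> climbs B B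
| climbs_up B M j : up j B -> climbs (r j B) M -> climbs B M.

Lemma climbs_ex B : Ob B -> exists M, climbs B M.
Proof.
move: B; apply: orbit_wf => B oB IH; have [tB|] := boolP (top B).
  by exists B; exact: climbs_top.
rewrite negb_forall => /existsP[j]; rewrite negbK => uj.
have [M hM] := IH _ (orbit_r j oB) uj.
by exists M; exact: climbs_up uj hM.
Qed.

Lemma climbs_orbit B M : Ob B -> climbs B M -> Ob M /\ top M.
Proof. by move=> oB h; elim: h oB => // {}B {}M j _ _ IH oB; exact/IH/orbit_r. Qed.

Lemma climbs_le B M : climbs B M -> B = M \/ ltB B M.
Proof.
elim=> [{}B _|{}B {}M j uj _ IH]; first by left.
by right; case: IH => [<- //|]; exact: ltB_trans.
Qed.

Lemma up_hexagon B i j : Ob B -> adj i j -> up i B -> up j B ->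
  [/\ up j (r i B), up i (r j B), up i (r j (r i B)) & up j (r i (r j B))].
Proof.
move=> oB aij ui uj; have gB := orbit_orthoset oB.
have aji : adj j i by rewrite adj_sym.
split; try exact: up_up_adj.
  by apply: up_adj_transport => //; exact: up_notin.
by apply: up_adj_transport => //; exact: up_notin.
Qed.

(** Local confluence: the two ascents meet at once, at the top of the hexagon, or at the top of the
    square. *)
Lemma up_join B i j : Ob B -> up i B -> up j B ->
  exists2 D, Ob D & forall M, climbs D M -> climbs (r i B) M /\ climbs (r j B) M.
Proof.
move=> oB ui uj; have gB := orbit_orthoset oB.
have [rij|/eqP rij] := eqVneq (r i B) (r j B).
  by exists (r i B); [exact: orbit_r | rewrite -rij].
have ij : i != j by apply/eqP => e; case: rij; rewrite e.
have [aij|aij] := boolP (adj i j).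
  have [u1 u2 u3 u4] := up_hexagon oB aij ui uj.
  exists (r i (r j (r i B))); first by do 3!apply: orbit_r.
  move=> M hM; split; first by apply: climbs_up u1 _; apply: climbs_up u3 _.
  by apply: climbs_up u2 _; apply: climbs_up u4 _; rewrite -r_braid.
have u1 := up_nadj oB ij aij rij ui.
have u2 : up j (r i B) by apply: up_nadj; rewrite 1?eq_sym 1?adj_sym //; exact: nesym.
exists (r i (r j B)); first by do 2!apply: orbit_r.
move=> M hM; split; last exact: climbs_up u1 hM.
by apply: climbs_up u2 _; rewrite -r_comm.
Qed.

(** Newman's lemma: by induction both ends equal the end of a chain starting at the join of the two
    first ascents. *)
Lemma climbs_uniq B M M' : Ob B -> climbs B M -> climbs B M' -> M = M'.
Proof.
move=> oB; move: B oB M M'; apply: orbit_wf => B oB IH M M' h h'.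
have topE C : top B -> climbs B C -> C = B.
  move=> tB hC; case: hC tB => // {}C L j uj _ /forallP/(_ j).
  by rewrite uj.
case: h oB IH h' topE => [{}B tB _ _ h' /(_ _ tB h') //|{}B {}M i ui hM oB IH h' _].
case: h' oB IH ui hM => [{}B tB _ _ ui|{}B {}M' j uj hM' oB IH ui hM].
  by move/forallP: tB => /(_ i); rewrite ui.
have [D oD hD] := up_join oB ui uj; have [L hL] := climbs_ex oD.
have [hi hj] := hD _ hL.
have -> : M = L by apply: (IH _ (orbit_r i oB) ui).
exact: (IH _ (orbit_r j oB) uj).
Qed.

Lemma orbit_status B i : Ob B ->
  [\/ alpha i \in B, perp B i, up i B | up i (r i B)].
Proof.
move=> oB; have gB := orbit_orthoset oB.
have [?|iB] := boolP (alpha i \in B); first exact: Or41.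
have [?|pB] := boolP (perp B i); first exact: Or42.
by have [?|?] := up_or_dn gB iB pB; [exact: Or43 | exact: Or44].
Qed.

(** Every [r i] fixes [B] or is an ascent in one of the two directions, so the end of the chains is
    constant on the orbit. *)
Lemma climbs_common : exists M, forall B, Ob B -> climbs B M.
Proof.
have [M hM] := climbs_ex orbit_base; exists M; apply: orbit_ind_r => // i B oB h.
have gB := orbit_orthoset oB; case: (orbit_status i oB) => hi.
- by rewrite r_fix ?hi.
- by rewrite r_fix ?hi ?orbT.
- have [L hL] := climbs_ex (orbit_r i oB).
  by rewrite (climbs_uniq oB h (climbs_up hi hL)).
- by apply: climbs_up hi _; rewrite rK.
Qed.

Lemma perp_r_self B i : orthoset B -> perp (r i B) i = perp B i.
Proof.
move=> gB; rewrite perp_r // refl_alpha; apply: eq_all => b.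
by rewrite ipNl oppr_eq0.
Qed.

Lemma up_neq B i j : orthoset B -> perp B i -> up j B -> j != i.
Proof.
by move=> gB pi uj; apply: contraTneq pi => <-; exact: up_nperp.
Qed.

(** Orthogonality to [alpha j] tells the two sets apart: by [perp_rr] it holds for the first and
    fails for the second. *)
Lemma r_neq_branch B i j k : Ob B -> adj i j -> adj k j -> perp B i -> ~~ perp B k ->
  r i (r j B) <> r k (r j B).
Proof.
move=> oB aij akj pi /negP npk e; apply: npk.
by rewrite -(perp_rr (orbit_orthoset oB) akj) -e perp_rr //; exact: orbit_orthoset.
Qed.

(** If they were equal, reflecting [b + alpha j] back by [r_k] would give an element of [B].
    Orthogonality to [alpha i] makes that element [b + alpha j - alpha k], which falls under [r_j]
    but has only the height of [b]. *)
Lemma r_neq_perp B i j k : Ob B -> adj j i -> adj k i -> j != k ->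
  perp B i -> up j B -> r j B <> r k B.
Proof.
move=> oB aji aki jk /allP pi uj e; have gB := orbit_orthoset oB.
have /(upP j gB)[b [bB bj hb]] := uj; have [nb h0] := gB.1 _ bB.
have aij : adj i j by rewrite adj_sym.
have aik : adj i k by rewrite adj_sym.
have ajk := no_triangle aij aik.
have rb : refl j b = b + alpha j by rewrite /Defs.refl bj scaleN1r opprK.
have : refl j b \in r k B.
  rewrite -e; apply: refl_in_r => //.
  by apply/eqP => e'; move: bj; rewrite e' ip_alphaii.
rewrite rb => bk; have nk : b + alpha j != alpha k.
  by apply/eqP => e'; have := congr1 (@ht n) e'; rewrite !htE; lia.
have := refl_of_r gB bk nk; rewrite /Defs.refl ipDl ip_alpha_nadj // addr0 => gB'.
have := pi _ gB'; have := pi _ bB => /eqP bi; rewrite !ipE bi !ip_alpha_adj //.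
move=> /eqP gi; have bk1 : ip b (alpha k) = 1 by lia.
have := hb _ gB'; rewrite bk1 !ipE bj ip_alphaii (ipC (alpha k)) ip_alpha_nadj //.
by rewrite !htE => /(_ erefl); lia.
Qed.

Variable B0 : {fset vec}.
Hypothesis climbsB0 : forall B, Ob B -> climbs B B0.

Lemma orbit_B0 : Ob B0.
Proof. exact: (climbs_orbit orbit_base (climbsB0 orbit_base)).1. Qed.

Lemma top_B0 j : up j B0 = false.
Proof.
have [_ /forallP/(_ j)] := climbs_orbit orbit_base (climbsB0 orbit_base).
exact: negbTE.
Qed.

Lemma up_ex B : Ob B -> B <> B0 -> exists j, up j B.
Proof.
move=> oB; have h := climbsB0 oB; case: h {oB} => [C _ []//|C M j uj _ _].
by exists j.
Qed.

(** * Conjugating [s_i] along ascents *)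

(** [carries B i k]: some [v] in [V(B,i)] conjugates [s_i] to [s_k]. *)
Inductive carries : {fset vec} -> 'I_n -> 'I_n -> Prop :=
| carries_base i : perp B0 i -> carries B0 i i
| carries_nadj B i j k : Ob B -> perp B i -> up j B -> j != i -> ~~ adj j i ->
    carries (r j B) i k -> carries B i k
| carries_adj B i j k : Ob B -> perp B i -> up j B -> adj j i ->
    carries (r i (r j B)) j k -> carries B i k.

Lemma carries_perp B i k : carries B i k -> perp B i /\ perp B0 k.
Proof. by elim=> // {}B {}i j {}k ? ? ? ? *; split=> //; tauto. Qed.

Lemma carriesN B i j k : Ob B -> up j B -> j != i -> ~~ adj j i ->
  carries (r j B) i k -> carries B i k.
Proof.
move=> oB uj ji aji h; refine (carries_nadj oB _ uj ji aji h).
have [+ _] := carries_perp h; rewrite perp_r_nadj 1?adj_sym 1?eq_sym //.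
exact: orbit_orthoset.
Qed.

Lemma carriesA B i j k : Ob B -> up j B -> adj j i ->
  carries (r i (r j B)) j k -> carries B i k.
Proof.
move=> oB uj aji h; refine (carries_adj oB _ uj aji h).
have [+ _] := carries_perp h; rewrite perp_rr 1?adj_sym //.
exact: orbit_orthoset.
Qed.

(** * Local confluence of the recursion defining [V(B,i)] *)

Definition next j B i := if adj j i then (r i (r j B), j) else (r j B, i).

Lemma next_orbit B i j : Ob B -> perp B i -> up j B ->
  [/\ Ob (next j B i).1, perp (next j B i).1 (next j B i).2 & ltB B (next j B i).1].
Proof.
move=> oB pi uj; have gB := orbit_orthoset oB; rewrite /next.
have ji := up_neq gB pi uj; case: ifP => [aji|/negbT aji] /=; split; auto.
- by rewrite perp_rr // adj_sym.
- by apply: (ltB_trans uj); apply: up_perp; rewrite 1?adj_sym.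
- by rewrite perp_r_nadj 1?adj_sym 1?eq_sym.
Qed.

(** The pair [(D, d)] is a common continuation of the steps along [j] and [k]. It lies above [B], so
    that induction applies to it. *)
Definition joined B i j k D d := [/\ Ob D, perp D d, ltB B D &
  forall l, carries D d l -> carries (next j B i).1 (next j B i).2 l /\
                             carries (next k B i).1 (next k B i).2 l].

Lemma joined_sym B i j k D d : joined B i j k D d -> joined B i k j D d.
Proof. by case=> oD pD BD h; split=> // l /h[]. Qed.

Section Join.
Variables (B : {fset vec}) (i j k : 'I_n).
Hypotheses (oB : Ob B) (pi : perp B i) (uj : up j B) (uk : up k B) (jk : j != k).
Let gB := orbit_orthoset oB.
Let ji := up_neq gB pi uj.
Let ki := up_neq gB pi uk.

Lemma join_nn : ~~ adj j i -> ~~ adj k i -> exists D d, joined B i j k D d.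
Proof.
move=> aji aki; have aij : ~~ adj i j by rewrite adj_sym.
have aik : ~~ adj i k by rewrite adj_sym.
have ij : i != j by rewrite eq_sym.
have ik : i != k by rewrite eq_sym.
rewrite /joined /next (negbTE aji) (negbTE aki) /=.
have [rjk|/eqP rjk] := eqVneq (r j B) (r k B).
  by exists (r j B), i; split; rewrite -?rjk ?perp_r_nadj //; auto.
have [ajk|ajk] := boolP (adj j k).
  have [u1 u2 u3 u4] := up_hexagon oB ajk uj uk.
  exists (r j (r k (r j B))), i; split; first by auto.
  - by rewrite !perp_r_nadj //; auto.
  - exact: ltB_trans uj (ltB_trans u1 u3).
  move=> l hl; split.
    by apply: (carriesN _ u1 _ _); auto; apply: (carriesN _ u3 _ _); auto.
  apply: (carriesN _ u2 _ _); auto; apply: (carriesN _ u4 _ _); auto.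
  by rewrite -r_braid.
have u1 : up j (r k B) by exact: up_nadj.
have u2 : up k (r j B) by apply: up_nadj; rewrite 1?eq_sym 1?adj_sym //; exact: nesym.
exists (r j (r k B)), i; split; first by auto.
- by rewrite !perp_r_nadj //; auto.
- exact: ltB_trans uk u1.
move=> l hl; split; last by apply: (carriesN _ u1 _ _); auto.
by apply: (carriesN _ u2 _ _); auto; rewrite -r_comm.
Qed.

(** If [j] and [k] are adjacent, then [i], [j], [k] form a path and both routes end at the same set
    because [i j k i j = j k i j k] in the Weyl group. Otherwise [r k] commutes with both other
    reflections. *)
Lemma join_an : adj j i -> ~~ adj k i -> exists D d, joined B i j k D d.
Proof.
move=> aji aki; have aij : adj i j by rewrite adj_sym.
have aik : ~~ adj i k by rewrite adj_sym.
have ik : i != k by rewrite eq_sym.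
have kj : k != j by rewrite eq_sym.
have oj : Ob (r j B) by auto.
have ok : Ob (r k B) by auto.
have gj := orbit_orthoset oj; have gk := orbit_orthoset ok.
have ui : up i (r j B) by exact: up_perp.
have npk : ~~ perp B k by exact: up_nperp.
have pik : perp (r k B) i by rewrite perp_r_nadj.
rewrite /joined /next aji (negbTE aki) /=.
have [ajk|ajk] := boolP (adj j k).
  have akj : adj k j by rewrite adj_sym.
  have [u1 u2 u3 u4] := up_hexagon oB ajk uj uk.
  have ne1 := r_neq_branch oB aij akj pi npk.
  have ne2 : r i (r j (r k B)) <> r k (r j (r k B)).
    by apply: r_neq_branch => //; rewrite perp_r_self.
  have ui2 : up i (r j (r k B)) by exact: up_perp.
  have v1 : up k (r i (r j B)) by apply: up_nadj => //; exact: nesym.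
  have v2 : up k (r i (r j (r k B))).
    by apply: up_nadj => //; [auto | exact: nesym].
  have uiZ : up i (r k (r j B)) by exact: up_nadj.
  have [w1 _ w3 _] := up_hexagon (orbit_r k oj) aij uiZ u3.
  rewrite (r_comm gj ik aik) in w1 w3.
  exists (r i (r j (r k (r i (r j B))))), k.
  have eD : r j (r k (r i (r j (r k B)))) = r i (r j (r k (r i (r j B)))).
    rewrite -(r_comm (B := r j (r k B)) _ ik aik); last by do 3?apply: orthoset_r.
    rewrite -(r_braid gB ajk) -(r_comm (B := r j B) _ ik aik) //.
    by rewrite r_braid //; do 3?apply: orthoset_r.
  split; first by auto 6.
  - rewrite -eD perp_rr //; last by apply: orbit_orthoset; auto 6.
    by rewrite perp_rr.
  - exact: (ltB_trans uj (ltB_trans ui (ltB_trans v1 (ltB_trans w1 w3)))).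
  move=> l hl; split.
    by apply: (carriesA _ v1 akj); [auto|]; apply: (carriesN _ w3 ik aik); auto 6.
  apply: (carriesA _ u2 aji) => //; apply: (carriesA _ v2 akj); [by auto|].
  by rewrite eD.
have rjk : r j B <> r k B.
  by move=> e; have := up_nperp gj ui; rewrite e pik.
have u1 : up k (r j B) by apply: up_nadj; rewrite 1?adj_sym //; exact: nesym.
have u2 : up j (r k B) by exact: up_nadj.
have akj : ~~ adj k j by rewrite adj_sym.
have ne : r k (r j B) <> r i (r j B).
  move=> e; have := perp_rr gB aij; rewrite -e pi perp_r_nadj // perp_r_self //.
  by rewrite (negbTE (up_nperp gB uj)).
have v1 : up k (r i (r j B)) by exact: up_nadj.
exists (r i (r j (r k B))), j; split; first by auto.
- by rewrite perp_rr.
- by apply: (ltB_trans uk); apply: (ltB_trans u2); exact: up_perp.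
move=> l hl; split; last exact: carriesA u2 aji _.
apply: (carriesN _ v1 kj akj); first by auto.
by rewrite -(r_comm gj ik aik) (r_comm gB kj akj).
Qed.

(** Here [j], [i], [k] form a path, since there are no triangles. The routes meet because
    [j i k i j = k i j i k], and both return to the node [i]. *)
Lemma join_aa : adj j i -> adj k i -> exists D d, joined B i j k D d.
Proof.
move=> aji aki; have aij : adj i j by rewrite adj_sym.
have aik : adj i k by rewrite adj_sym.
have kj : k != j by rewrite eq_sym.
have ajk := no_triangle aij aik; have akj := no_triangle aik aij.
have oj : Ob (r j B) by auto.
have ok : Ob (r k B) by auto.
have rjk := r_neq_perp oB aji aki jk pi uj.
have u1 : up k (r j B) by apply: up_nadj => //; exact: nesym.
have u2 : up j (r k B) by exact: up_nadj.
have u3 : up i (r j B) by exact: up_perp.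
have u4 : up i (r k B) by exact: up_perp.
have [v1 _ v2 _] := up_hexagon oj aik u3 u1.
have [w1 _ w2 _] := up_hexagon ok aij u4 u2.
have gj := orbit_orthoset oj; have gk := orbit_orthoset ok.
have eD : r k (r i (r j (r i (r k B)))) = r j (r i (r k (r i (r j B)))).
  rewrite (r_braid gk aij) (r_braid gj aik) (r_comm gB jk ajk).
  by rewrite r_comm //; do 3?apply: orthoset_r.
rewrite /joined /next aji aki /=.
exists (r j (r i (r k (r i (r j B))))), i; split; first by auto 6.
- rewrite perp_rr //; last by apply: orbit_orthoset; auto 6.
  by rewrite perp_r_nadj ?perp_rr //; apply: orbit_orthoset; auto.
- apply: (ltB_trans uj); apply: (ltB_trans u3); apply: (ltB_trans v1).
  apply: (ltB_trans v2).
  apply: up_perp => //; first by apply: orbit_orthoset; auto 6.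
  by rewrite perp_r_nadj ?perp_rr //; apply: orbit_orthoset; auto.
move=> l hl; split.
  by apply: (carriesN _ v1 kj akj); [auto|]; apply: (carriesA _ v2 aij); auto.
apply: (carriesN _ w1 jk ajk); [by auto|]; apply: (carriesA _ w2 aik); first by auto.
by rewrite eD.
Qed.

End Join.

Lemma carries_inv B i k : carries B i k -> (B = B0 /\ k = i) \/
  exists2 j, up j B & carries (next j B i).1 (next j B i).2 k.
Proof.
case=> [{}i _|{}B {}i j {}k oB pi uj ji aji h|{}B {}i j {}k oB pi uj aji h].
- by left.
- by right; exists j; rewrite // /next (negbTE aji).
- by right; exists j; rewrite // /next aji.
Qed.

Lemma carries_next B i j k : Ob B -> perp B i -> up j B ->
  carries (next j B i).1 (next j B i).2 k -> carries B i k.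
Proof.
move=> oB pi uj; have ji := up_neq (orbit_orthoset oB) pi uj.
by rewrite /next; case: ifP => [aji|/negbT aji]; [exact: carriesA | exact: carriesN].
Qed.

(** Newman's argument again, now for pairs of a set and a node, with the join lemmas as local
    confluence. *)
Lemma carries_unique B : Ob B -> forall i, perp B i ->
  exists2 k, carries B i k & forall k', carries B i k' -> k' = k.
Proof.
move: B; apply: orbit_wf => B oB IH i pi.
have [eB|/eqP nB] := eqVneq B B0.
  exists i; first by rewrite eB; apply: carries_base; rewrite -eB.
  move=> k' /carries_inv[[_ ->]//|[j]]; by rewrite eB top_B0.
have [j uj] := up_ex oB nB; have [o1 p1 l1] := next_orbit oB pi uj.
have [k hk uk] := IH _ o1 l1 _ p1; exists k; first exact: carries_next uj hk.
move=> k' /carries_inv[[//]|[j' uj' h']].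
have [jj'|jj'] := eqVneq j j'; first by apply: uk; rewrite jj'.
have [o2 p2 l2] := next_orbit oB pi uj'; have [k2 _ uk2] := IH _ o2 l2 _ p2.
have [D [d [oD pD lD hD]]] : exists D d, joined B i j j' D d.
  have j'j : j' != j by rewrite eq_sym.
  have [aj|aj] := boolP (adj j i); have [aj'|aj'] := boolP (adj j' i).
  - exact: join_aa.
  - exact: join_an.
  - by have [D [d /joined_sym h]] := join_an oB pi uj' uj j'j aj' aj; exists D, d.
  - exact: join_nn.
have [l hl _] := IH _ oD lD _ pD; have [h1 h2] := hD _ hl.
by rewrite (uk2 _ h') -(uk2 _ h2) (uk _ h1).
Qed.

Lemma carries_ex B i : Ob B -> perp B i -> exists k, carries B i k.
Proof. by move=> oB pi; have [k] := carries_unique oB pi; exists k. Qed.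

Lemma carries_inj B i k k' : Ob B -> carries B i k -> carries B i k' -> k = k'.
Proof.
move=> oB h h'; have [pi _] := carries_perp h.
by have [l _ u] := carries_unique oB pi; rewrite (u _ h) (u _ h').
Qed.

(** Needed for [T k] and [T l] to commute where [B] is orthogonal to both roots. One ascent [p] is
    followed to a higher set with two non-adjacent nodes carried to the same [k] and [l]. *)
Lemma carries_nadj_nadj B i j k l : Ob B -> i != j -> ~~ adj i j ->
  carries B i k -> carries B j l -> ~~ adj k l.
Proof.
move=> oB; move: B oB i j k l; apply: orbit_wf => B oB IH i j k l ij aij hk hl.
have [pi _] := carries_perp hk; have [pj _] := carries_perp hl.
have gB := orbit_orthoset oB.
have [eB|/eqP nB] := eqVneq B B0.
  case: (carries_inv hk) => [[_ ->]|[p]]; last by rewrite eB top_B0.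
  by case: (carries_inv hl) => [[_ ->]//|[p]]; rewrite eB top_B0.
have [p up_] := up_ex oB nB.
have reduce D i' j' : Ob D -> ltB B D -> i' != j' -> ~~ adj i' j' ->
    perp D i' -> perp D j' ->
    (forall k', carries D i' k' -> carries B i k') ->
    (forall l', carries D j' l' -> carries B j l') -> ~~ adj k l.
  move=> oD lD ij' aij' pi' pj' hi hj.
  have [k' hk'] := carries_ex oD pi'; have [l' hl'] := carries_ex oD pj'.
  rewrite (carries_inj oB hk (hi _ hk')) (carries_inj oB hl (hj _ hl')).
  exact: (IH _ oD lD _ _ _ _ ij' aij' hk' hl').
have pi_ := up_neq gB pi up_; have pj_ := up_neq gB pj up_.
have ip_ : i != p by rewrite eq_sym.
have jp_ : j != p by rewrite eq_sym.
have ji : j != i by rewrite eq_sym.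
have aji : ~~ adj j i by rewrite adj_sym.
have op := orbit_r p oB; have gp := orbit_orthoset op.
have mixed a b : adj p a -> ~~ adj p b -> a != b -> ~~ adj a b ->
    perp B a -> perp B b -> p != b ->
    [/\ Ob (r a (r p B)), ltB B (r a (r p B)), perp (r a (r p B)) p,
        perp (r a (r p B)) b &
        (forall k', carries (r a (r p B)) p k' -> carries B a k') /\
        (forall l', carries (r a (r p B)) b l' -> carries B b l')].
  move=> apa apb ab aab pa pb pb_; have aap : adj a p by rewrite adj_sym.
  have ua : up a (r p B) by exact: up_perp.
  have ba : b != a by rewrite eq_sym.
  have bp : b != p by rewrite eq_sym.
  have aba : ~~ adj b a by rewrite adj_sym.
  have abp : ~~ adj b p by rewrite adj_sym.
  split; [by auto | exact: ltB_trans up_ ua | by rewrite perp_rr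
         | by rewrite !perp_r_nadj | split=> m hm].
    exact: carriesA hm.
  by apply: (carriesN oB up_ pb_ apb); apply: (carriesN op ua ab aab).
have [api|api] := boolP (adj p i); have [apj|apj] := boolP (adj p j).
- have aip : adj i p by rewrite adj_sym.
  have ajp : adj j p by rewrite adj_sym.
  have ui : up i (r p B) by exact: up_perp.
  have uj : up j (r p B) by exact: up_perp.
  have pD : perp (r i (r p B)) p by rewrite perp_rr.
  (* If the two branches coincide, both nodes continue as [p] at the same set, so [k = l] and
     irreflexivity concludes. *)
  have [e|/eqP ne] := eqVneq (r i (r p B)) (r j (r p B)).
    have [m hm] := carries_ex (orbit_r i op) pD.
    rewrite (carries_inj oB hk (carriesA oB up_ api hm)).
    by rewrite e in hm; rewrite (carries_inj oB hl (carriesA oB up_ apj hm)) adj_irr.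
  have u1 : up j (r i (r p B)) by apply: up_nadj => //; exact: nesym.
  have u2 : up i (r j (r p B)) by exact: up_nadj.
  have oi : Ob (r i (r p B)) by auto.
  have oj : Ob (r j (r p B)) by auto.
  have eD : r p (r i (r j (r p B))) = r p (r j (r i (r p B))).
    by rewrite (r_comm gp ij aij).
  have goi := orbit_orthoset oi; have goj := orbit_orthoset oj.
  apply: (reduce (r p (r j (r i (r p B)))) j i) => //; try by auto 6.
  + apply: ltB_trans up_ _; apply: ltB_trans ui _; apply: (ltB_trans u1).
    exact: up_perp.
  + by rewrite perp_rr.
  + by rewrite -eD perp_rr // perp_rr.
  + by move=> m hm; apply: (carriesA oB up_ api); exact: (carriesA oi u1 ajp).
  + move=> m hm; apply: (carriesA oB up_ apj); apply: (carriesA oj u2 aip).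
    by rewrite eD.
- have [? ? ? ? [? ?]] := mixed _ _ api apj ij aij pi pj pj_.
  exact: (reduce (r i (r p B)) p j).
- have [? ? ? ? [? ?]] := mixed _ _ apj api ji aji pj pi pi_.
  by apply: (reduce (r j (r p B)) i p); rewrite // adj_sym.
- have aip : ~~ adj i p by rewrite adj_sym.
  have ajp : ~~ adj j p by rewrite adj_sym.
  apply: (reduce (r p B) i j) => //; rewrite ?perp_r_nadj // => m.
    exact: carriesN.
  exact: carriesN.
Qed.

(** The same scheme, giving the braid relation between [T k] and [T l]. An ascent [p] adjacent to
    both nodes would form a triangle. *)
Lemma carries_adj_adj B i j k l : Ob B -> adj i j ->
  carries B i k -> carries B j l -> adj k l.
Proof.
move=> oB; move: B oB i j k l; apply: orbit_wf => B oB IH i j k l aij hk hl.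
have [pi _] := carries_perp hk; have [pj _] := carries_perp hl.
have gB := orbit_orthoset oB.
have [eB|/eqP nB] := eqVneq B B0.
  case: (carries_inv hk) => [[_ ->]|[p]]; last by rewrite eB top_B0.
  by case: (carries_inv hl) => [[_ ->]//|[p]]; rewrite eB top_B0.
have [p up_] := up_ex oB nB.
have reduce D i' j' : Ob D -> ltB B D -> adj i' j' ->
    perp D i' -> perp D j' ->
    (forall k', carries D i' k' -> carries B i k') ->
    (forall l', carries D j' l' -> carries B j l') -> adj k l.
  move=> oD lD aij' pi' pj' hi hj.
  have [k' hk'] := carries_ex oD pi'; have [l' hl'] := carries_ex oD pj'.
  rewrite (carries_inj oB hk (hi _ hk')) (carries_inj oB hl (hj _ hl')).
  exact: (IH _ oD lD _ _ _ _ aij' hk' hl').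
have op := orbit_r p oB; have gp := orbit_orthoset op.
(* On the path [p], [a], [b], the ascents [p], [a], [b] turn the nodes [a], [b] into [p], [a]. *)
have mixed a b : adj p a -> ~~ adj p b -> adj a b -> perp B a -> perp B b ->
    [/\ Ob (r b (r a (r p B))), ltB B (r b (r a (r p B))),
        perp (r b (r a (r p B))) p, perp (r b (r a (r p B))) a &
        (forall k', carries (r b (r a (r p B))) p k' -> carries B a k') /\
        (forall l', carries (r b (r a (r p B))) a l' -> carries B b l')].
  move=> apa apb aab pa pb; have aap : adj a p by rewrite adj_sym.
  have pb_ := up_neq gB pb up_; have bp : b != p by rewrite eq_sym.
  have abp : ~~ adj b p by rewrite adj_sym.
  have aba : adj b a by rewrite adj_sym.
  have ua : up a (r p B) by exact: up_perp.
  have pbp : perp (r p B) b by rewrite perp_r_nadj.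
  have oa : Ob (r a (r p B)) by auto.
  have ub : up b (r a (r p B)) by exact: up_perp.
  have goa := orbit_orthoset oa.
  split; [by auto | exact: ltB_trans up_ (ltB_trans ua ub)
         | by rewrite perp_r_nadj // perp_rr | by rewrite perp_rr | split=> m hm].
    by apply: (carriesA oB up_ apa); exact: (carriesN oa ub bp abp).
  by apply: (carriesN oB up_ pb_ apb); exact: (carriesA op ua aab).
have [api|api] := boolP (adj p i); have [apj|apj] := boolP (adj p j).
- by have := no_triangle api apj; rewrite aij.
- have [? ? ? ? [? ?]] := mixed _ _ api apj aij pi pj.
  exact: (reduce (r j (r i (r p B))) p i).
- have aji : adj j i by rewrite adj_sym.
  have [? ? ? ? [? ?]] := mixed _ _ apj api aji pj pi.
  by apply: (reduce (r i (r j (r p B))) j p); rewrite // adj_sym.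
- have pi_ := up_neq gB pi up_; have pj_ := up_neq gB pj up_.
  apply: (reduce (r p B) i j) => //.
  + by rewrite perp_r_nadj 1?eq_sym 1?adj_sym.
  + by rewrite perp_r_nadj 1?eq_sym 1?adj_sym.
  + by move=> m; exact: carriesN.
  + by move=> m; exact: carriesN.
Qed.

(** * The representation *)

(** The witness is [alpha i], of height 1. A falling [g] has height above 1 because its reflection
    is positive, and not 2 by [ht_up_down]. *)
Lemma up_of_alpha B i j : orthoset B -> adj i j -> alpha i \in B -> up j B.
Proof.
move=> gB aij iB; apply/(upP j gB); exists (alpha i); split=> //.
  exact: ip_alpha_adj.
move=> g gB' gj; have [ng hg] := gB.1 _ gB'.
have := norm2_ht (ht_up_down gB iB gB' (ip_alpha_adj aij) gj).
have := @ht_refl_ip j _ ng hg; rewrite gj => /(_ isT); rewrite !htE; lia.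
Qed.

Lemma perp_notin B i : perp B i -> alpha i \notin B.
Proof.
by move=> /allP pi; apply/negP => /pi; rewrite ip_alphaii.
Qed.

(** On the orbit, for [alpha i] orthogonal to [B], this is the unique node with [h_{B,i} = s_k];
    elsewhere the choice is arbitrary. *)
Definition kappa B i : 'I_n := epsilon (inhabits i) (carries B i).

Lemma kappaP B i : Ob B -> perp B i -> carries B i (kappa B i).
Proof. by move=> oB pi; apply: epsilon_spec; exact: carries_ex. Qed.

(** * The transposed operators over an algebra satisfying the Hecke relations *)

Section HeckeModule.
Variables (A : algType F) (T Ti : 'I_n -> A).
Hypothesis relT : hecke_rels adj T Ti.
Local Notation m := mF.

Lemma T_adj i j : adj i j -> T i * T j * T i = T j * T i * T j.
Proof. exact: relT.2.1. Qed.

Lemma T_nadj i j : ~~ adj i j -> T i * T j = T j * T i.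
Proof.
by have [->|ij] := eqVneq i j => // aij; exact: relT.2.2.1.
Qed.

Lemma T_sq i : T i * T i = 1 - m *: T i.
Proof. exact: relT.2.2.2. Qed.

(** The transpose of [tau_i], acting on functionals [g] on the module. *)
Definition cotau i (g : {fset vec} -> A) B : A :=
  if alpha i \in B then 0
  else if perp B i then g B * T (kappa B i)
  else if ltB (r i B) B then g (r i B)
  else if ltB B (r i B) then g (r i B) - m *: g B
  else 0.

Lemma cotau_in i g B : alpha i \in B -> cotau i g B = 0.
Proof. by rewrite /cotau => ->. Qed.

Lemma cotau_perp i g B k : Ob B -> carries B i k -> cotau i g B = g B * T k.
Proof.
move=> oB h; have [pi _] := carries_perp h.
rewrite /cotau (negbTE (perp_notin pi)) pi.
by rewrite (carries_inj oB (kappaP oB pi) h).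
Qed.

Lemma cotau_up i g B : Ob B -> up i B -> cotau i g B = g (r i B) - m *: g B.
Proof.
move=> oB ui; have gB := orbit_orthoset oB.
rewrite /cotau (negbTE (up_notin gB ui)) (negbTE (up_nperp gB ui)) ui.
by case: ifP => // /(ltB_asym ui).
Qed.

Lemma cotau_dn i g B : Ob B -> up i B -> cotau i g (r i B) = g B.
Proof.
move=> oB ui; have gB := orbit_orthoset oB.
rewrite /cotau alpha_in_r // (negbTE (up_notin gB ui)) perp_r_self //.
by rewrite (negbTE (up_nperp gB ui)) rK // ui.
Qed.

Lemma cotau_dnE i g B : Ob B -> up i (r i B) -> cotau i g B = g (r i B).
Proof.
move=> oB ui; rewrite -{1}(rK i (orbit_orthoset oB)) cotau_dn //; exact: orbit_r.
Qed.

Lemma carries_r_nadj B i j k : Ob B -> i != j -> ~~ adj i j -> up j B ->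
  carries B i k -> carries (r j B) i k.
Proof.
move=> oB ij aij uj h; have [pi _] := carries_perp h.
have ji : j != i by rewrite eq_sym.
have aji : ~~ adj j i by rewrite adj_sym.
have [|k' h'] := @carries_ex (r j B) i (orbit_r j oB).
  by rewrite perp_r_nadj //; exact: orbit_orthoset.
by rewrite (carries_inj oB h (carriesN oB uj ji aji h')).
Qed.

Section Commutation.
Variables (i j : 'I_n).
Hypotheses (ij : i != j) (aij : ~~ adj i j).

Lemma cotau_comm_in g B : Ob B -> alpha i \in B ->
  cotau i (cotau j g) B = cotau j (cotau i g) B.
Proof.
move=> oB iB; have gB := orbit_orthoset oB.
have irB : alpha i \in r j B by rewrite alpha_in_r_nadj.
rewrite (cotau_in _ iB); case: (orbit_status j oB) => hj.
- by rewrite (cotau_in _ hj).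
- by rewrite (cotau_perp _ oB (kappaP oB hj)) cotau_in // mul0r.
- by rewrite (cotau_up _ oB hj) !cotau_in // scaler0 subr0.
- by rewrite (cotau_dnE _ oB hj) cotau_in.
Qed.

Lemma cotau_comm_perp g B : Ob B -> perp B i -> alpha j \notin B ->
  cotau i (cotau j g) B = cotau j (cotau i g) B.
Proof.
move=> oB pi jB; have gB := orbit_orthoset oB.
have hk := kappaP oB pi; rewrite (cotau_perp _ oB hk).
case: (orbit_status j oB) => hj; first by rewrite hj in jB.
- have hl := kappaP oB hj; rewrite !(cotau_perp _ oB hl) (cotau_perp _ oB hk).
  rewrite -!mulrA T_nadj //; apply: carries_nadj_nadj oB _ _ hl hk.
    by rewrite eq_sym.
  by rewrite adj_sym.
- rewrite !(cotau_up _ oB hj) (cotau_perp _ oB hk).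
  rewrite (cotau_perp _ (orbit_r j oB) (carries_r_nadj oB ij aij hj hk)).
  by rewrite mulrBl scalerAl.
- rewrite !(cotau_dnE _ oB hj) (@cotau_perp i _ _ (kappa B i)) //; first by auto.
  by apply: (carriesN (orbit_r j oB) hj); rewrite ?rK // 1?eq_sym 1?adj_sym.
Qed.
End Commutation.

(** Once neither root lies in [B] or is orthogonal to it, the orbit is a single edge or a square
    whose opposite edges point the same way. *)
Lemma cotau_comm i j g B : i != j -> ~~ adj i j -> Ob B ->
  cotau i (cotau j g) B = cotau j (cotau i g) B.
Proof.
move=> ij aij oB; have gB := orbit_orthoset oB.
have ji : j != i by rewrite eq_sym.
have aji : ~~ adj j i by rewrite adj_sym.
have [iB|iB] := boolP (alpha i \in B); first exact: cotau_comm_in.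
have [jB|jB] := boolP (alpha j \in B); first by rewrite (cotau_comm_in ji aji).
have [pi|pi] := boolP (perp B i); first exact: cotau_comm_perp.
have [pj|pj] := boolP (perp B j); first by rewrite (cotau_comm_perp ji aji).
have oi := orbit_r i oB; have oj := orbit_r j oB.
have [e|/eqP ne] := eqVneq (r i B) (r j B).
  have ei : r i (r i B) = B by exact: rK.
  have ej : r j (r i B) = B by rewrite e rK.
  have [ui|di] := up_or_dn gB iB pi.
    have uj : up j B by rewrite -e.
    have Cj f : cotau j f (r i B) = f B by rewrite e (cotau_dn _ oB uj).
    by rewrite !(cotau_up _ oB ui, cotau_up _ oB uj) -e !(cotau_dn _ oB ui, Cj).
  have dj : up j (r j B) by rewrite -e ej -{2}ei.
  have uj : up j (r i B) by rewrite e.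
  rewrite !(cotau_dnE _ oB di, cotau_dnE _ oB dj) -e.
  by rewrite !(cotau_up _ oi uj, cotau_up _ oi di) ei ej.
have ne' := nesym ne; have rC := r_comm gB ij aij.
have [ui|di] := up_or_dn gB iB pi; have [uj|dj] := up_or_dn gB jB pj.
- have ui' := up_nadj oB ij aij ne ui; have uj' := up_nadj oB ji aji ne' uj.
  rewrite !(cotau_up _ oB ui, cotau_up _ oB uj, cotau_up _ oj ui', cotau_up _ oi uj').
  rewrite rC !scalerBr !opprB -!addrA; congr (_ + _).
  by rewrite addrCA [RHS]addrCA; congr (_ + _); exact: addrC.
- have ui' := up_nadj oB ij aij ne ui; have dj' := dn_nadj oB ji aji ne' dj.
  rewrite !(cotau_up _ oB ui, cotau_dnE _ oB dj).
  by rewrite (cotau_dnE _ oi dj') (cotau_up _ oj ui') rC.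
- have di' := dn_nadj oB ij aij ne di; have uj' := up_nadj oB ji aji ne' uj.
  rewrite !(cotau_dnE _ oB di, cotau_up _ oB uj).
  by rewrite (cotau_dnE _ oj di') (cotau_up _ oi uj') rC.
- have di' := dn_nadj oB ij aij ne di; have dj' := dn_nadj oB ji aji ne' dj.
  rewrite !(cotau_dnE _ oB di, cotau_dnE _ oB dj).
  by rewrite (cotau_dnE _ oj di') (cotau_dnE _ oi dj') rC.
Qed.

(** The set [X] is the bottom of the hexagon. The two vertices not listed follow by exchanging [i]
    and [j]. *)
Lemma cotau_hexagon i j g X : adj i j -> Ob X -> up i X -> up j X ->
  [/\ cotau i (cotau j (cotau i g)) X = cotau j (cotau i (cotau j g)) X,
      cotau i (cotau j (cotau i g)) (r i X) = cotau j (cotau i (cotau j g)) (r i X),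
      cotau i (cotau j (cotau i g)) (r j (r i X)) =
        cotau j (cotau i (cotau j g)) (r j (r i X)) &
      cotau i (cotau j (cotau i g)) (r i (r j (r i X))) =
        cotau j (cotau i (cotau j g)) (r i (r j (r i X)))].
Proof.
move=> aij oX ui uj; have gX := orbit_orthoset oX.
have [u1 u2 u3 u4] := up_hexagon oX aij ui uj; have eT := r_braid gX aij.
have oa : Ob (r i X) by auto.
have ob : Ob (r j X) by auto.
have oc : Ob (r j (r i X)) by auto.
have od : Ob (r i (r j X)) by auto.
have Tj f : cotau j f (r i (r j (r i X))) = f (r i (r j X)).
  by rewrite eT (cotau_dn _ od u4).
have Dj f : cotau j f (r i (r j X)) = f (r i (r j (r i X))) - m *: f (r i (r j X)).
  by rewrite (cotau_up _ od u4) -eT.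
have rules := (Tj, Dj, cotau_up _ oX ui, cotau_up _ oX uj, cotau_dn _ oX ui,
  cotau_dn _ oX uj, cotau_up _ oa u1, cotau_dn _ oa u1, cotau_up _ ob u2,
  cotau_dn _ ob u2, cotau_up _ oc u3, cotau_dn _ oc u3).
split; rewrite !rules //.
  rewrite !scalerBr !opprB -!addrA; congr (_ + _).
  by rewrite !addrA [RHS](ACl (6*2*5*4*3*1)).
by rewrite !scalerBr !opprB !addrA [RHS](ACl (1*4*3*2)).
Qed.

(** The orbit is [X < r j X < r i (r j X)]. At the bottom [i], and at the top [j], acts by the same
    [T k], so the identity at [X] comes down to the quadratic relation. *)
Lemma cotau_chain i j k g X : adj i j -> Ob X -> carries X i k -> up j X ->
  [/\ cotau i (cotau j (cotau i g)) X = cotau j (cotau i (cotau j g)) X,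
      cotau i (cotau j (cotau i g)) (r j X) = cotau j (cotau i (cotau j g)) (r j X) &
      cotau i (cotau j (cotau i g)) (r i (r j X)) =
        cotau j (cotau i (cotau j g)) (r i (r j X))].
Proof.
move=> aij oX hk uj; have gX := orbit_orthoset oX; have [pi _] := carries_perp hk.
have aji : adj j i by rewrite adj_sym.
have o2 : Ob (r j X) by auto.
have o3 : Ob (r i (r j X)) by auto.
have ui : up i (r j X) by exact: up_perp.
have hk3 : carries (r i (r j X)) j k.
  have [|k' h'] := @carries_ex _ j o3; first by rewrite perp_rr.
  by rewrite (carries_inj oX hk (carriesA oX uj aji h')).
have rules := (cotau_perp _ oX hk, cotau_perp _ o3 hk3, cotau_up _ oX uj,
  cotau_dn _ oX uj, cotau_up _ o2 ui, cotau_dn _ o2 ui).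
split; rewrite !rules //.
  rewrite !mulrBl -!scalerAl -mulrA T_sq !(mulrBr, mulr1) -scalerAr.
  by rewrite !scalerBr !opprB !addrA [RHS](ACl (1*4*3*2)).
by rewrite mulrBl scalerAl.
Qed.

(** The sets [X] and [r i (r j X)] contain [alpha i] and [alpha j] respectively, and both lie below
    [r j X]. Both sides vanish; the third vertex follows by exchanging [i] and [j]. *)
Lemma cotau_vee i j g X : adj i j -> Ob X -> alpha i \in X ->
  cotau i (cotau j (cotau i g)) X = cotau j (cotau i (cotau j g)) X /\
  cotau i (cotau j (cotau i g)) (r j X) = cotau j (cotau i (cotau j g)) (r j X).
Proof.
move=> aij oX iX; have gX := orbit_orthoset oX.
have aji : adj j i by rewrite adj_sym.
have o2 : Ob (r j X) by auto.
have o3 : Ob (r i (r j X)) by auto.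
have uj := up_of_alpha gX aij iX.
have jX3 : alpha j \in r i (r j X).
  rewrite alpha_in_r_adj //; last exact: orbit_orthoset.
  have -> : alpha j + alpha i = refl j (alpha i) by rewrite refl_alpha_adj.
  apply: refl_in_r => //; apply/eqP => e.
  by have := ip_alpha_adj aij; rewrite e ip_alphaii.
have ui : up i (r i (r j X)) by exact: up_of_alpha (orbit_orthoset o3) aji jX3.
by split; rewrite !(cotau_in _ iX, cotau_in _ jX3, cotau_up _ oX uj,
  cotau_dn _ oX uj, cotau_dnE _ o2 ui) ?scaler0 ?subr0.
Qed.

(** The cases locate [B] inside its [<r_i, r_j>]-orbit. The presence of [alpha i], [alpha j] or
    their sum in [B] places it at an end or in the middle of a V. *)
Lemma cotau_braid i j g B : adj i j -> Ob B ->
  cotau i (cotau j (cotau i g)) B = cotau j (cotau i (cotau j g)) B.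
Proof.
move=> aij oB; have gB := orbit_orthoset oB.
have aji : adj j i by rewrite adj_sym.
have oi := orbit_r i oB; have oj := orbit_r j oB.
have gi := orbit_orthoset oi; have gj := orbit_orthoset oj.
have [iB|iB] := boolP (alpha i \in B); first exact: (cotau_vee g aij oB iB).1.
have [jB|jB] := boolP (alpha j \in B); first by have [-> _] := cotau_vee g aji oB jB.
have [ijB|ijB] := boolP (alpha i + alpha j \in B).
  have [|_] := @cotau_vee i j g (r j B) aij oj; first by rewrite alpha_in_r_adj.
  by rewrite rK.
have irB : alpha i \notin r j B by rewrite alpha_in_r_adj.
have jrB : alpha j \notin r i B by rewrite alpha_in_r_adj // addrC.
(* Here [B] is an end of a 3-chain: the bottom if [b] ascends, the top otherwise. *)
have perp_case a b : adj a b -> perp B a -> ~~ perp B b -> alpha b \notin B ->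
    alpha a \notin r b B ->
    cotau a (cotau b (cotau a g)) B = cotau b (cotau a (cotau b g)) B.
  move=> aab pa pb bB arB; have aba : adj b a by rewrite adj_sym.
  have ob := orbit_r b oB; have gb := orbit_orthoset ob.
  have [ub|db] := up_or_dn gB bB pb.
    by have [] := cotau_chain g aab oB (kappaP oB pa) ub.
  have ra : r a B = B by rewrite r_fix ?pa ?orbT.
  have eB : r b (r a (r a (r b B))) = B by rewrite !rK.
  have pX : perp (r a (r b B)) b by rewrite perp_rr.
  have ua : up a (r a (r b B)).
    by have := up_adj_transport gb aba arB db; rewrite -r_braid // ra.
  have oX : Ob (r a (r b B)) by auto.
  by have [_ _] := cotau_chain g aba oX (kappaP oX pX) ua; rewrite eB.
have [pi|pi] := boolP (perp B i); have [pj|pj] := boolP (perp B j).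
- have hk := kappaP oB pi; have hl := kappaP oB pj.
  rewrite !(cotau_perp _ oB hk, cotau_perp _ oB hl) -!mulrA; congr (_ * _).
  by rewrite !mulrA T_adj //; exact: carries_adj_adj oB aij hk hl.
- exact: perp_case.
- by rewrite (perp_case j i).
(* With one ascent and one descent, [B] is the middle of a 3-chain or a side vertex of a hexagon;
   the status of [a] at [r b B] decides which. *)
have mid a b : adj a b -> ~~ perp B a -> alpha a \notin B -> alpha b \notin B ->
    alpha a \notin r b B -> up a B -> up b (r b B) ->
    cotau a (cotau b (cotau a g)) B = cotau b (cotau a (cotau b g)) B.
  move=> aab pa aB bB arB ua db; have aba : adj b a by rewrite adj_sym.
  have ob := orbit_r b oB; have gb := orbit_orthoset ob.
  case: (orbit_status a ob) => ha; first by rewrite ha in arB.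
  - by have [_ + _] := cotau_chain g aab ob (kappaP ob ha) db; rewrite rK.
  - by have [_ + _ _] := cotau_hexagon g aba ob db ha; rewrite rK.
  have ub : up b (r a (r b B)) by exact: up_adj_transport.
  have oX : Ob (r a (r b B)) by auto.
  by have [_ _ + _] := cotau_hexagon g aab oX ha ub; rewrite !rK.
have [ui|di] := up_or_dn gB iB pi; have [uj|dj] := up_or_dn gB jB pj.
- by have [] := cotau_hexagon g aij oB ui uj.
- exact: mid.
- by rewrite (mid j i).
(* Only the top of a hexagon remains; its bottom is the opposite vertex. *)
have u1 : up j (r i (r j (r i B))) by exact: up_adj_transport.
have u2 : up i (r i (r j (r i B))).
  by rewrite r_braid //; exact: up_adj_transport.
have oX : Ob (r i (r j (r i B))) by auto.
have [_ _ _] := cotau_hexagon g aij oX u2 u1.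
by rewrite !rK //; do 3?apply: orthoset_r.
Qed.

(** * From functionals back to the module *)

Definition hval B i : hterm n := HS (kappa B i).
Local Notation tau := (tau adj (@ltB n) hval).

Definition pairing (g : {fset vec} -> A) (s : velem n) : A :=
  \sum_(p <- s) g p.1 * heval T Ti p.2.

Lemma pairing_tau i g s : pairing g (tau i s) = pairing (cotau i g) s.
Proof.
rewrite /pairing /Defs.tau big_flatten big_map; apply: eq_bigr => -[B z] _ /=.
rewrite /tau_basis /cotau -!rsetE; case: ifP => _; first by rewrite big_nil mul0r.
case: ifP => _; first by rewrite big_seq1 /= mulrA.
case: ifP => _; first by rewrite big_seq1.
case: ifP => _; last by rewrite big_nil mul0r.
rewrite big_cons big_seq1 /= mulrBl; congr (_ + _).
by rewrite scaleNr mulNr mulrN -!scalerAl mul1r scalerAr.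
Qed.

(** Transposition reverses composition, so here the first letter acts first. *)
Fixpoint cotau_word (u : seq 'I_n) g :=
  if u is i :: u' then cotau_word u' (cotau i g) else g.

Lemma pairing_tau_word u g s :
  pairing g (tau_word adj (@ltB n) hval u s) = pairing (cotau_word u g) s.
Proof. by elim: u g => //= i u IH g; rewrite pairing_tau IH. Qed.

Lemma cotau_ext i g g' : (forall B, Ob B -> g B = g' B) ->
  forall B, Ob B -> cotau i g B = cotau i g' B.
Proof.
by move=> gg B oB; rewrite /cotau (gg B oB) (gg _ (orbit_r i oB)).
Qed.

Lemma cotau_word_ext u g g' : (forall B, Ob B -> g B = g' B) ->
  forall B, Ob B -> cotau_word u g B = cotau_word u g' B.
Proof. by elim: u g g' => //= i u IH g g' gg; apply: IH; exact: cotau_ext. Qed.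

Lemma cotau_word_cat u v g : cotau_word (u ++ v) g = cotau_word v (cotau_word u g).
Proof. by elim: u g => //=. Qed.

Lemma cotau_word_braid u u' : braid_eq adj u u' ->
  forall g B, Ob B -> cotau_word u g B = cotau_word u' g B.
Proof.
elim=> [//|{}u v _ IH|{}u v w _ IH1 _ IH2|{}u v i j aij|{}u v i j ij aij] g B oB.
- by rewrite IH.
- by rewrite IH1 ?IH2.
- rewrite !cotau_word_cat /=; apply: cotau_word_ext oB => C oC.
  exact: cotau_braid.
- rewrite !cotau_word_cat /=; apply: cotau_word_ext oB => C oC.
  by rewrite cotau_comm // 1?eq_sym // adj_sym.
Qed.

(** Coefficients are pairings with indicator functionals, so identities between transposed operators
    suffice for equality in the module. *)
Lemma heval_coef B s :
  heval T Ti (coef B s) = pairing (fun C => if C == B then 1 else 0) s.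
Proof.
rewrite /pairing; elim: s => [|[C z] s IH] /=; first by rewrite big_nil scale0r.
by rewrite big_cons /=; case: eqP => _ /=; rewrite IH ?mul1r // mul0r add0r.
Qed.

Lemma heval_hinvword v : heval T Ti (hinvword v) * heval T Ti (hword v) = 1.
Proof.
elim: v => [|j v IH]; first by rewrite /= !scale1r mulr1.
have foldlE t : heval T Ti (foldl (fun t j => HMul (HSi j) t) t v) =
    heval T Ti (hinvword v) * heval T Ti t.
  rewrite /hinvword; elim: v {IH} t => [|l v IH] t /=; first by rewrite scale1r mul1r.
  by rewrite IH /= [in RHS]IH /= scale1r mulr1 mulrA.
have [_ TiT] := relT.1 j.
by rewrite {1}/hinvword /= foldlE /= scale1r mulr1 -mulrA (mulrA (Ti j)) TiT mul1r.
Qed.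

(** Induction gives [s_i v = v s_k]: the first letter of [v] commutes with [s_i], or its first two
    letters are passed by [s_i s_j s_i = s_j s_i s_j], which turns [i] into [j]. *)
Lemma heval_conj B i v : Vset adj Ob (@ltB n) B0 B i v -> exists2 k,
  carries B i k & heval T Ti (conj_term v i) = T k.
Proof.
move=> h; suff [k hk e] : exists2 k, carries B i k &
    T i * heval T Ti (hword v) = heval T Ti (hword v) * T k.
  by exists k; rewrite //= e mulrA heval_hinvword mul1r.
elim: h => [{}i pi|{}B {}i j {}v oB pi uj ji aji _ [k hk e]|
            {}B {}i j {}v oB pi uj aji _ [k hk e]].
- by exists i; [exact: carries_base | rewrite /= scale1r mulr1 mul1r].
- rewrite -!rsetE in uj hk; exists k; first exact: carriesN hk.
  by rewrite /= mulrA T_nadj 1?adj_sym // -!mulrA e.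
- rewrite -!rsetE in uj hk; exists k; first exact: carriesA hk.
  by rewrite /= !mulrA T_adj 1?adj_sym // -!mulrA e !mulrA.
Qed.

End HeckeModule.

(** * Existence of words and assembly of the result *)

Lemma Vset_ex B : Ob B -> forall i, perp B i ->
  exists v, Vset adj Ob (@ltB n) B0 B i v.
Proof.
move: B; apply: orbit_wf => B oB IH i pi.
have [eB|/eqP nB] := eqVneq B B0.
  by exists [::]; rewrite eB; apply: Vset_base; rewrite -eB.
have [j uj] := up_ex oB nB; have [o1 p1 l1] := next_orbit oB pi uj.
have ji := up_neq (orbit_orthoset oB) pi uj.
have [v hv] := IH _ o1 l1 _ p1; move: hv; rewrite /next.
case: ifP => [aji|/negbT aji] hv.
  by exists (j :: i :: v); apply: Vset_adj => //; rewrite -!rsetE.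
by exists (j :: v); apply: Vset_nadj => //; rewrite -!rsetE.
Qed.

Lemma low_root_order_works :
  strict_porder_on Ob (@ltB n) /\
  unique_maximal Ob (@ltB n) B0 /\
  (forall B, Ob B -> B != B0 -> exists j : 'I_n, ltB B (actB adj [:: j] B)) /\
  (forall B (i : 'I_n), Ob B -> alpha i \notin B -> ~~ perp B i ->
     actB adj [:: i] B != B /\
     (ltB B (actB adj [:: i] B) || ltB (actB adj [:: i] B) B)) /\
  exists h : {fset vec} -> 'I_n -> hterm n,
    (forall B (i : 'I_n), Ob B -> perp B i ->
       in_Z (fun k => perp B0 k) (h B i) /\
       (exists v, Vset adj Ob (@ltB n) B0 B i v) /\
       (forall v, Vset adj Ob (@ltB n) B0 B i v ->
          hecke_eq adj (conj_term v i) (h B i))) /\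
    (forall u u' : seq 'I_n, braid_eq adj u u' -> forall B, Ob B ->
       veq adj (tau_word adj (@ltB n) h u [:: (B, HK n 1)])
               (tau_word adj (@ltB n) h u' [:: (B, HK n 1)])).
Proof.
split; first by split=> [B _|B C D _ _ _]; [exact: ltB_irr | exact: ltB_trans].
split.
  split.
    split; first exact: orbit_B0.
    move=> C oC; apply/negP => lt0C.
    case: (climbs_le (climbsB0 oC)) => [e|/(ltB_asym lt0C)//].
    by rewrite e (negbTE (ltB_irr _)) in lt0C.
  move=> B [oB maxB]; have [//|/eqP /(up_ex oB)[j uj]] := eqVneq B B0.
  by have := maxB _ (orbit_r j oB); rewrite uj.
split; first by move=> B oB /eqP /(up_ex oB)[j]; rewrite rsetE; exists j.
split.
  move=> B i oB iB pi; rewrite -rsetE; have gB := orbit_orthoset oB.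
  case: (up_or_dn gB iB pi) => h.
    by rewrite h; split=> //; apply/eqP => e; rewrite e (negbTE (ltB_irr _)) in h.
  rewrite rK // in h; rewrite h orbT; split=> //.
  by apply/eqP => e; rewrite e (negbTE (ltB_irr _)) in h.
exists hval; split=> [B i oB pi|u u' uu' B oB C A T Ti relT].
  have hk := kappaP oB pi; split; first exact: (carries_perp hk).2.
  split; first exact: Vset_ex.
  move=> v hv A T Ti relT; have [k hk' ->] := heval_conj relT hv.
  by rewrite /= (carries_inj oB hk hk').
rewrite !heval_coef !pairing_tau_word /pairing !big_seq1 /=.
by rewrite (cotau_word_braid relT uu').
Qed.
End Lattice.

Theorem theorem1p1 (n : nat) (adj : rel 'I_n) (B1 : {fset 'rV[int]_n}) :
  simply_laced_diagram adj -> spherical adj ->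
  orth_posroots adj B1 -> admissible adj B1 ->
  exists (lt : rel {fset 'rV[int]_n}) (B0 : {fset 'rV[int]_n}),
    strict_porder_on (Worbit adj B1) lt /\
    unique_maximal (Worbit adj B1) lt B0 /\
    (forall B, Worbit adj B1 B -> B != B0 ->
       exists j : 'I_n, lt B (actB adj [:: j] B)) /\
    (forall B (i : 'I_n), Worbit adj B1 B ->
       alpha i \notin B -> ~~ perpB adj B (alpha i) ->
       actB adj [:: i] B != B /\
       (lt B (actB adj [:: i] B) || lt (actB adj [:: i] B) B)) /\
    exists h : {fset 'rV[int]_n} -> 'I_n -> hterm n,
      (forall B (i : 'I_n), Worbit adj B1 B -> perpB adj B (alpha i) ->
         in_Z (fun k => perpB adj B0 (alpha k)) (h B i) /\
         (exists v, Vset adj (Worbit adj B1) lt B0 B i v) /\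
         (forall v, Vset adj (Worbit adj B1) lt B0 B i v ->
            hecke_eq adj (conj_term v i) (h B i))) /\
      (forall u u' : seq 'I_n, braid_eq adj u u' ->
         forall B, Worbit adj B1 B ->
           veq adj (tau_word adj lt h u [:: (B, HK n 1)])
                   (tau_word adj lt h u' [:: (B, HK n 1)])).
Proof.
move=> [asym airr] sph /(orth_posroots_orthoset asym sph) g1 adm.
have [B0 hB0] := climbs_common asym airr sph g1 adm.
by exists (@ltB n), B0; exact: low_root_order_works.
Qed.
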